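(* Let $\beta\in\{1,2,4\}$, $p>\beta/2$, $c>1$. The gamma ensemble on $\mathbb{H}_{2,\beta}$ with parameters $p,c$ is a Meixner ensemble with parameters $$A=\frac1{1+2p},\quad B=0,\quad C=0.$$ For $\mathbf X$ with this law, the mean and the variance are $\mathbb{E}(\mathbf X)=2pc\sqrt{1+\beta}\,\mathbf I_2$ and $\mathrm{Var}(\mathbf X)=4pc^2(1+\beta)\mathbf I_2$. For the standardized version $\widetilde{\mathbf X}$ of $\mathbf X$ (with $\widetilde{\mathbf Y}$ an independent copy and $\widetilde{\mathbf S}=\widetilde{\mathbf X}+\widetilde{\mathbf Y}$), $$\mathbb{E}\big((\widetilde{\mathbf X}-\widetilde{\mathbf Y})^2\big|\widetilde{\mathbf S}\big)=\frac2{1+2a}\left(\mathbf I_2+b\widetilde{\mathbf S}+a\widetilde{\mathbf S}^2\right)$$ holds with $a=\frac1{4p}$ and $b=\frac1{\sqrt p}$.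
   Context: For $\beta=1,2,4$, $\mathbb{H}_{2,\beta}$ is the real vector space of $2\times2$ real symmetric, complex Hermitian, respectively quaternionic Hermitian matrices, with inner product $\langle x|y\rangle=\Re\,\mathrm{tr}(xy)$; the determinant of the matrix with diagonal entries $x,y$ and off-diagonal entry $z$ is $xy-|z|^2$. A law $\mu$ on $\mathbb{H}_{2,\beta}$ is rotation invariant if $U\mathbf XU^*\sim\mathbf X$ for all $U$ in $O(2)$, $U(2)$, $Sp(2)$ (quaternionic unitary matrices) respectively when $\mathbf X\sim\mu$. $\mu$ is a Meixner ensemble with parameters $A,B,C\in\mathbb R$ if it is rotation invariant, has finite second moments, and for $\mathbf X,\mathbf Y$ independent with law $\mu$ and $\mathbf S=\mathbf X+\mathbf Y$ one has $\mathbb{E}((\mathbf X-\mathbf Y)^2|\mathbf S)=A\mathbf S^2+B\mathbf S+C\mathbf I_2$. $\mathrm{Var}(\mathbf X)=\mathbb{E}(\mathbf X^2)-(\mathbb{E}\mathbf X)^2$; if $\mathbb{E}\mathbf X=m\mathbf I_2$ and $\mathrm{Var}(\mathbf X)=s^2\mathbf I_2$ with $s>0$, the standardized version is $\widetilde{\mathbf X}=(\mathbf X-m\mathbf I_2)/s$. The gamma ensemble with parameters $p>\beta/2$, $c>1$ is the law on $\mathbb{H}_{2,\beta}$ with Laplace transform $$\mathbb{E}(e^{\langle\theta|\mathbf X\rangle})=\left(1-2c\sqrt{1+\beta}\,\mathrm{tr}\,\theta+\beta(\mathrm{tr}\,\theta)^2+4\det\theta\right)^{-p}$$ for $\theta$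 in the connected component containing $\mathbf 0$ of the set where the expression in parentheses is positive. Such a law is known to exist: for $p>\beta/2$, $c>1$ there is a probability measure $\nu_{p,c}$ on the cone $\{x\in\mathbb R^{\beta+2}:x_0>(\sum_{r=1}^{\beta+1}x_r^2)^{1/2}\}$ with Laplace transform $\int e^{\sum s_rx_r}\nu_{p,c}(dx)=(1-2cs_0+s_0^2-\sum_{r=1}^{\beta+1}s_r^2)^{-p}$ (a result of Letac and Wesołowski), and if $(\xi_0,\dots,\xi_{\beta+1})\sim\nu_{p,c}$ then $\mathbf X$ is the matrix with diagonal entries $\sqrt{1+\beta}\,\xi_0\pm\xi_1$ and upper off-diagonal entry $\xi_2$ ($\beta=1$), $\xi_2+i\xi_3$ ($\beta=2$), $\xi_2+i\xi_3+j\xi_4+k\xi_5$ ($\beta=4$). *)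

(* Defs.v *)
From HB Require Import structures.
From mathcomp Require Import all_boot all_order all_algebra.
From mathcomp Require Import all_classical all_reals all_analysis.
From mathcomp Require Import complex ring.

Set Implicit Arguments.
Unset Strict Implicit.
Unset Printing Implicit Defensive.

Import Order.TTheory GRing.Theory Num.Theory.
Import numFieldNormedType.Exports.

Local Open Scope classical_set_scope.
Local Open Scope ring_scope.

(** * Real quaternions a + b i + c j + d k *)

Record quat (R : Type) := Quat { qre : R; qi : R; qj : R; qk : R }.

Definition quat_tuple (R : Type) (x : quat R) := (qre x, qi x, qj x, qk x).
Definition tuple_quat (R : Type) (t : R * R * R * R) :=
  let: (a, b, c, d) := t in Quat a b c d.

Lemma quat_tupleK (R : Type) : cancel (@quat_tuple R) (@tuple_quat R).
Proof. by case. Qed.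

HB.instance Definition _ (R : choiceType) :=
  Choice.copy (quat R) (can_type (@quat_tupleK R)).

Section QuaternionRing.
Variable R : realType.
Implicit Types x y z : quat R.

Definition quat_add x y :=
  Quat (qre x + qre y) (qi x + qi y) (qj x + qj y) (qk x + qk y).
Definition quat_opp x := Quat (- qre x) (- qi x) (- qj x) (- qk x).
Definition quat_mul x y :=
  Quat (qre x * qre y - qi x * qi y - qj x * qj y - qk x * qk y)
       (qre x * qi y + qi x * qre y + qj x * qk y - qk x * qj y)
       (qre x * qj y - qi x * qk y + qj x * qre y + qk x * qi y)
       (qre x * qk y + qi x * qj y - qj x * qi y + qk x * qre y).
Definition quat_conj x := Quat (qre x) (- qi x) (- qj x) (- qk x).

Lemma quat_addA : associative quat_add.
Proof. by move=> x y z; rewrite /quat_add /= !addrA. Qed.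

Lemma quat_addC : commutative quat_add.
Proof. by move=> x y; rewrite /quat_add; congr Quat; exact: addrC. Qed.

Lemma quat_add0 : left_id (Quat 0 0 0 0) quat_add.
Proof. by case=> a b c d; rewrite /quat_add /= !add0r. Qed.

Lemma quat_addN : left_inverse (Quat 0 0 0 0) quat_opp quat_add.
Proof. by case=> a b c d; rewrite /quat_add /= !addNr. Qed.

HB.instance Definition _ :=
  GRing.isZmodule.Build (quat R) quat_addA quat_addC quat_add0 quat_addN.

Lemma quat_mulA : associative quat_mul.
Proof. by move=> x y z; rewrite /quat_mul /=; congr Quat; ring. Qed.

Lemma quat_mul1l : left_id (Quat 1 0 0 0) quat_mul.
Proof. by case=> a b c d; rewrite /quat_mul /=; congr Quat; ring. Qed.

Lemma quat_mul1r : right_id (Quat 1 0 0 0) quat_mul.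
Proof. by case=> a b c d; rewrite /quat_mul /=; congr Quat; ring. Qed.

Lemma quat_mulDl : left_distributive quat_mul quat_add.
Proof. by move=> x y z; rewrite /quat_mul /quat_add /=; congr Quat; ring. Qed.

Lemma quat_mulDr : right_distributive quat_mul quat_add.
Proof. by move=> x y z; rewrite /quat_mul /quat_add /=; congr Quat; ring. Qed.

Lemma quat_oner_neq0 : Quat 1 0 0 0 != 0 :> quat R.
Proof. by apply/eqP => -[/eqP]; rewrite oner_eq0. Qed.

HB.instance Definition _ := GRing.Zmodule_isNzRing.Build (quat R)
  quat_mulA quat_mul1l quat_mul1r quat_mulDl quat_mulDr quat_oner_neq0.

End QuaternionRing.

(** * The real division algebra R, C or H attached to beta = 1, 2 or 4 *)

Variant dyson := Dyson1 | Dyson2 | Dyson4.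

Definition dyson_index (b : dyson) : nat :=
  match b with Dyson1 => 1 | Dyson2 => 2 | Dyson4 => 4 end.
Coercion dyson_index : dyson >-> nat.

Section DivisionAlgebra.
Variable R : realType.

Definition hring (b : dyson) : nzRingType :=
  match b with
  | Dyson1 => R : nzRingType
  | Dyson2 => R[i] : nzRingType
  | Dyson4 => quat R : nzRingType
  end.

Definition hconj (b : dyson) : hring b -> hring b :=
  match b with
  | Dyson1 => fun z : R => z
  | Dyson2 => @conjc R
  | Dyson4 => @quat_conj R
  end.

Definition hreal (b : dyson) : R -> hring b :=
  match b with
  | Dyson1 => fun a : R => a
  | Dyson2 => fun a => a%:C%C
  | Dyson4 => fun a => Quat a 0 0 0
  end.

Definition hRe (b : dyson) : hring b -> R :=
  match b with
  | Dyson1 => fun z : R => z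
  | Dyson2 => @complex.Re R
  | Dyson4 => @qre R
  end.

(* The coordinates in the real bases (1), (1, i) and (1, i, j, k). *)
Definition hcoord (b : dyson) : hring b -> 'rV[R]_b :=
  match b with
  | Dyson1 => fun z : R => \row_(_ < 1) z
  | Dyson2 => fun z : R[i] =>
      \row_(r < 2) [:: complex.Re z; complex.Im z]`_r
  | Dyson4 => fun z : quat R =>
      \row_(r < 4) [:: qre z; qi z; qj z; qk z]`_r
  end.

Definition of_hcoord (b : dyson) : 'rV[R]_b -> hring b :=
  match b with
  | Dyson1 => fun v : 'rV_1 => v 0 0
  | Dyson2 => fun v : 'rV_2 => (v 0 0 +i* v 0 1)%C
  | Dyson4 => fun v : 'rV_4 =>
      Quat (v 0 0) (v 0 1) (v 0 (inord 2)) (v 0 (inord 3))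
  end.

Lemma hcoordK b : cancel (@hcoord b) (@of_hcoord b).
Proof.
case: b => /= z; rewrite ?mxE //=; first by case: z.
by rewrite !inordK //=; case: z.
Qed.

Definition hnormsq (b : dyson) (z : hring b) : R :=
  \sum_(r < b) hcoord z 0 r ^+ 2.

Lemma hconjB b (x y : hring b) : hconj (x - y) = hconj x - hconj y.
Proof.
case: b x y => //= x y; first by rewrite rmorphB.
by congr Quat; rewrite /= opprD.
Qed.

Lemma hconj0 b : hconj (0 : hring b) = 0.
Proof. by have := hconjB (0 : hring b) 0; rewrite !subrr. Qed.

Lemma hconjD b (x y : hring b) : hconj (x + y) = hconj x + hconj y.
Proof. by rewrite -[y]opprK hconjB -(sub0r (- y)) hconjB hconj0 sub0r. Qed.

Lemma hconjM b (x y : hring b) : hconj (x * y) = hconj y * hconj x.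
Proof.
case: b x y => /=; first by move=> x y; rewrite mulrC.
  by move=> x y; rewrite rmorphM mulrC.
by move=> x y; rewrite /GRing.mul /=; congr Quat => /=; ring.
Qed.

Lemma hconjK b : involutive (@hconj b).
Proof. by case: b => //=; [exact: conjcK | case=> *; congr Quat; exact: opprK]. Qed.

Lemma hconj_real b a : hconj (hreal b a) = hreal b a.
Proof. by case: b => //=; rewrite /conjc /quat_conj ?oppr0 //=; congr Quat; rewrite oppr0. Qed.

Lemma hrealC b a (z : hring b) : hreal b a * z = z * hreal b a.
Proof.
case: b z => /=; first by move=> z; rewrite mulrC.
  by move=> z; rewrite mulrC.
by case=> *; rewrite /GRing.mul /=; congr Quat => /=; ring.
Qed.

Lemma hreal1 b : hreal b 1 = 1. Proof. by case: b. Qed.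

Lemma hrealD b x y : hreal b (x + y) = hreal b x + hreal b y.
Proof.
case: b => //=; first by rewrite -rmorphD.
by rewrite /GRing.add /= /quat_add /= !addr0.
Qed.

Lemma hrealM b x y : hreal b (x * y) = hreal b x * hreal b y.
Proof.
case: b => //=; first by rewrite rmorphM.
by rewrite -[RHS]/(quat_mul (Quat x 0 0 0) (Quat y 0 0 0)) /quat_mul /=; congr Quat; ring.
Qed.

(** * The real vector space H_(2,beta) of Hermitian 2 x 2 matrices *)

Definition adjmx (b : dyson) (M : 'M[hring b]_2) : 'M[hring b]_2 :=
  map_mx (@hconj b) M^T.

Definition is_herm (b : dyson) : {pred 'M[hring b]_2} :=
  fun M => adjmx M == M.

Lemma adjmxM b (M N : 'M[hring b]_2) :
  adjmx (M *m N) = adjmx N *m adjmx M.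
Proof.
apply/matrixP => i j; rewrite !mxE (big_morph _ (@hconjD b) (@hconj0 b)).
by apply: eq_bigr => k _; rewrite !mxE hconjM.
Qed.

Lemma adjmxK b : involutive (@adjmx b).
Proof. by move=> M; apply/matrixP => i j; rewrite !mxE hconjK. Qed.

Lemma is_herm_zmod_closed b : zmod_closed (@is_herm b).
Proof.
split=> [|M N /eqP hM /eqP hN]; apply/eqP/matrixP => i j.
  by rewrite !mxE hconj0.
by rewrite -{2}hM -{2}hN !mxE hconjB.
Qed.

HB.instance Definition _ (b : dyson) :=
  GRing.isZmodClosed.Build _ (@is_herm b) (@is_herm_zmod_closed b).

Record herm (b : dyson) :=
  Herm { herm_mx :> 'M[hring b]_2; hermP : herm_mx \in @is_herm b }.

HB.instance Definition _ b := [isSub for @herm_mx b].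
HB.instance Definition _ b := [Choice of herm b by <:].
HB.instance Definition _ b := [SubChoice_isSubZmodule of herm b by <:].
HB.instance Definition _ b := isPointed.Build (herm b) 0.

Lemma is_herm_scale b (a : R) (x : herm b) :
  hreal b a *: herm_mx x \in @is_herm b.
Proof.
have /eqP hx := hermP x; apply/eqP/matrixP => i j.
by rewrite -{2}hx !mxE hconjM hconj_real hrealC.
Qed.

Definition herm_scale b (a : R) (x : herm b) : herm b :=
  Herm (is_herm_scale a x).

Lemma herm_scaleA b (s t : R) (x : herm b) :
  herm_scale s (herm_scale t x) = herm_scale (s * t) x.
Proof. by apply: val_inj; rewrite /= scalerA hrealM. Qed.

Lemma herm_scale1 b : left_id 1 (@herm_scale b).
Proof. by move=> x; apply: val_inj; rewrite /= hreal1 scale1r. Qed.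

Lemma herm_scaleDr b : right_distributive (@herm_scale b) +%R.
Proof. by move=> s x y; apply: val_inj; rewrite /= scalerDr. Qed.

Lemma herm_scaleDl b (x : herm b) :
  {morph (@herm_scale b)^~ x : s t / s + t}.
Proof. by move=> s t; apply: val_inj; rewrite /= hrealD scalerDl. Qed.

HB.instance Definition _ b := GRing.Zmodule_isLmodule.Build R (herm b)
  (@herm_scaleA b) (@herm_scale1 b) (@herm_scaleDr b) (@herm_scaleDl b).

Lemma is_herm1 b : (1%:M : 'M[hring b]_2) \in @is_herm b.
Proof.
apply/eqP/matrixP => i j; rewrite !mxE eq_sym.
by case: (i == j); rewrite ?hconj0 // -hreal1 hconj_real.
Qed.

Definition herm1 b : herm b := Herm (is_herm1 b).

Definition hinner b (x y : herm b) : R :=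
  hRe (\tr (herm_mx x *m herm_mx y)).

(* The trace and the diagonal entries of a Hermitian matrix are real. *)
Definition htr b (x : herm b) : R := hRe (\tr (herm_mx x)).

Definition hdet b (x : herm b) : R :=
  hRe (x 0 0) * hRe (x 1 1) - hnormsq (x 0 1).

Definition unitary b (U : 'M[hring b]_2) : Prop :=
  U *m adjmx U = 1%:M /\ adjmx U *m U = 1%:M.

Lemma is_herm_conj b (U : 'M[hring b]_2) (x : herm b) :
  U *m x *m adjmx U \in @is_herm b.
Proof.
have /eqP hx := hermP x.
by apply/eqP; rewrite !adjmxM adjmxK hx mulmxA.
Qed.

Definition herm_conj b (U : 'M[hring b]_2) (x : herm b) : herm b :=
  Herm (is_herm_conj U x).

(** ** Euclidean topology and Borel sigma-algebra of H_(2,beta) *)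

Definition herm_coords b (x : herm b) : 'M['rV[R]_b]_2 :=
  \matrix_(i, j) hcoord (x i j).

HB.instance Definition _ b :=
  Topological.copy (herm b) (initial_topology (@herm_coords b)).

Definition herm_coord_sets b : set (set (herm b)) :=
  \bigcup_(k in [set: 'I_2 * 'I_2 * 'I_b])
    preimage_set_system setT
      (fun x : herm b => hcoord (x k.1.1 k.1.2) 0 k.2) measurable.

Definition herm_measurable b : set (set (herm b)) := <<s @herm_coord_sets b >>.

Lemma herm_measurable0 b : @herm_measurable b set0.
Proof. exact: sigma_algebra0. Qed.

Lemma herm_measurableC b (A : set (herm b)) :
  herm_measurable A -> herm_measurable (~` A).
Proof. exact: sigma_algebraC. Qed.

Lemma herm_measurableU b (F : (set (herm b))^nat) :
  (forall i, herm_measurable (F i)) -> herm_measurable (\bigcup_i F i).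
Proof. exact: sigma_algebra_bigcup. Qed.

End DivisionAlgebra.

Definition herm_display (R : realType) (b : dyson) : measure_display.
Proof. by constructor. Qed.

HB.instance Definition _ (R : realType) (b : dyson) :=
  @isMeasurable.Build (herm_display R b) (herm R b) (@herm_measurable R b)
    (@herm_measurable0 R b) (@herm_measurableC R b) (@herm_measurableU R b).

(** * Laws, independence and conditional expectation *)

Section Probability.
Context {d : measure_display} {T : measurableType d} {R : realType}.
Variable P : probability T R.

Definition has_law {d'} {E : measurableType d'} (X : T -> E)
    (mu : probability E R) : Prop :=
  measurable_fun setT X /\
  forall A, measurable A -> P (X @^-1` A) = mu A.

Definition same_law {d'} {E : measurableType d'} (X Y : T -> E) : Prop :=
  [/\ measurable_fun setT X, measurable_fun setT Y &
      forall A, measurable A -> P (X @^-1` A) = P (Y @^-1` A)].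

Definition independent {d'} {E : measurableType d'} (X Y : T -> E) : Prop :=
  forall A B, measurable A -> measurable B ->
    P (X @^-1` A `&` Y @^-1` B) = (P (X @^-1` A) * P (Y @^-1` B))%E.

(* W is a version of E(Z | S), the conditional expectation of Z with respect
   to the sigma-algebra generated by S. *)
Definition is_cond_exp {d'} {E : measurableType d'}
    (Z : T -> R) (S : T -> E) (W : T -> R) : Prop :=
  [/\ P.-integrable setT (EFin \o Z),
      P.-integrable setT (EFin \o W),
      forall B, measurable B ->
        preimage_set_system setT S measurable (W @^-1` B) &
      forall A, measurable A ->
        (\int[P]_(w in S @^-1` A) (W w)%:E
         = \int[P]_(w in S @^-1` A) (Z w)%:E)%E].

Variable b : dyson.

(* Expectations of matrices are taken coordinatewise. *)
Definition mx_cond_exp {d'} {E : measurableType d'}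
    (Z : T -> 'M[hring R b]_2) (S : T -> E) (W : T -> 'M[hring R b]_2) : Prop :=
  forall (i j : 'I_2) (r : 'I_b),
    is_cond_exp (fun w => hcoord (Z w i j) 0 r) S
                (fun w => hcoord (W w i j) 0 r).

Definition mx_exp (M : T -> 'M[hring R b]_2) : 'M[hring R b]_2 :=
  \matrix_(i, j) of_hcoord (\row_r fine 'E_P[fun w => hcoord (M w i j) 0 r]).

Definition mx_var (M : T -> 'M[hring R b]_2) : 'M[hring R b]_2 :=
  mx_exp (fun w => M w ^+ 2) - mx_exp M ^+ 2.

Definition standardized (X Xt : T -> herm R b) : Prop :=
  exists m s : R,
    [/\ 0 < s, mx_exp X = (hreal b m)%:M, mx_var X = (hreal b (s ^+ 2))%:M &
        forall w, Xt w = s^-1 *: (X w - m *: herm1 R b)].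

End Probability.

(** * Meixner ensembles and gamma ensembles *)

Section Ensembles.
Context {R : realType} {b : dyson}.

Definition rotation_invariant (mu : probability (herm R b) R) : Prop :=
  forall (U : 'M[hring R b]_2), unitary U ->
  forall (d : measure_display) (T : measurableType d) (P : probability T R)
         (X : T -> herm R b),
    has_law P X mu -> has_law P (fun w => herm_conj U (X w)) mu.

Definition finite_second_moments (mu : probability (herm R b) R) : Prop :=
  (\int[mu]_x (hinner x x)%:E < +oo)%E.

Definition meixner_ensemble (mu : probability (herm R b) R) (A B C : R) : Prop :=
  [/\ rotation_invariant mu,
      finite_second_moments mu &
      forall (d : measure_display) (T : measurableType d) (P : probability T R)
             (X Y : T -> herm R b),
        has_law P X mu -> has_law P Y mu -> independent P X Y ->
        let S w := X w + Y w in
        mx_cond_exp P (fun w => herm_mx (X w - Y w) ^+ 2) S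
          (fun w => hreal b A *: herm_mx (S w) ^+ 2
                    + hreal b B *: herm_mx (S w) + (hreal b C)%:M)].

Definition gamma_expr (c : R) (t : herm R b) : R :=
  1 - 2 * c * Num.sqrt (1 + b%:R) * htr t + b%:R * htr t ^+ 2 + 4 * hdet t.

Definition gamma_domain (c : R) : set (herm R b) :=
  connected_component [set t | 0 < gamma_expr c t] 0.

Definition gamma_ensemble (mu : probability (herm R b) R) (p c : R) : Prop :=
  forall t, gamma_domain c t ->
    (\int[mu]_x (expR (hinner t x))%:E = (gamma_expr c t `^ (- p))%:E)%E.

End Ensembles.

(* Main.v *)
Require Import Defs.
From HB Require Import structures.
From mathcomp Require Import all_boot all_order all_algebra.
From mathcomp Require Import all_classical all_reals all_analysis measurable_realfun.
From mathcomp Require Import complex ring lra.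

(** With Q the quadratic polynomial of the gamma law, L(t) = Q(t)^(-p), X and Y
independent and S = X + Y, second derivatives of L(t + sv) L(t - sv) and of
L(t + sv)^2 at s = 0 give the Laplace transforms, as signed measures in S, of
<v, X - Y>^2 and <v, S>^2.  The combination <v, X - Y>^2 - <v, S>^2 / (1 + 2p)
has transform proportional to the purely quadratic part of Q at v, and every
real coordinate of x^2 is a combination of squares <v, x>^2 along which these
quadratic parts cancel.

The Laplace transform on the opposite of a cone of positive matrices forces the
law to live in the dual cone; through u_i = exp(- <v_i, x>) uniqueness becomes
a Hausdorff moment problem on a cube, settled coordinate by coordinate with
explicit polynomials approximating indicators of intervals.  Uniqueness yields
both the regression identity and rotation invariance, since Q(t) depends only
on tr t and Re tr t^2. *)

Set Implicit Arguments.
Unset Strict Implicit.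
Unset Printing Implicit Defensive.

Import Order.TTheory GRing.Theory Num.Theory.
Import numFieldNormedType.Exports.
Local Open Scope classical_set_scope.
Local Open Scope ring_scope.

(** * Moments on the unit interval *)

(** The obstacle is uniqueness: [gamma_ensemble] gives the Laplace transform only on a real domain,
    and the regression identity compares densities that may change sign. Uniqueness is therefore
    proved for integrals weighted by arbitrary integrable functions, and tested only at opposites of
    diagonally dominant matrices.

    The value 1/(1+2p) is the ratio of the coefficients of the squared slope of Q, which are 2p for
    the difference and 2p(2p+1) for the sum. The coefficient beta of (tr)^2 in Q is what makes the
    remaining quadratic parts cancel: a diagonal entry of x^2 is the square of a diagonal entry of
    x, whose direction has quadratic part beta, plus the squares of beta off-diagonal coordinates,
    whose directions have quadratic part -1 each. Off-diagonal entries of x^2 arise by polarization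
    from two directions with equal quadratic part. The same cancellation makes E(X^2) a multiple of
    the identity, which gives the variance. *)

Section StepPolynomials.
Variable R : realType.
Implicit Types (a x y : R) (n : nat).

Lemma bernoulli_ge y n : 0 <= y <= 1 -> 1 - n%:R * y <= (1 - y) ^+ n.
Proof.
move=> /andP[y0 y1]; elim: n => [|n IH]; first by rewrite mul0r subr0 expr0.
have y1' : 0 <= 1 - y by rewrite subr_ge0.
rewrite exprS; apply: le_trans (ler_wpM2l y1' IH).
have n0 : 0 <= n%:R :> R by [].
rewrite -natr1 -subr_ge0 [leRHS](_ : _ = n%:R * y ^+ 2); last by ring.
by rewrite mulr_ge0 // sqr_ge0.
Qed.

(** In the form (1 - y)^n <= 1 / (1 + n y), this upper counterpart of Bernoulli's inequality forces
    (1 - y)^n to 0 once n y tends to infinity. *)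
Lemma bernoulli_le y n : 0 <= y <= 1 -> (1 - y) ^+ n * (1 + n%:R * y) <= 1.
Proof.
move=> /andP[y0 y1]; elim: n => [|n IH]; first by rewrite expr0 mul0r addr0 mulr1.
apply: le_trans IH; rewrite exprS -natr1.
have e0 : 0 <= (1 - y) ^+ n by rewrite exprn_ge0 // subr_ge0.
rewrite [leLHS](_ : _ = (1 - y) ^+ n * ((1 - y) * (1 + (n%:R + 1) * y))); last by ring.
apply: ler_wpM2l => //; rewrite -subr_ge0.
rewrite [leRHS](_ : _ = (n%:R + 1) * y ^+ 2); last by ring.
by rewrite mulr_ge0 ?sqr_ge0 ?addr_ge0.
Qed.

(** The division by n matters at the endpoint: for x = a it gives N x^n <= 1/n, so the limit is 1
    there too, while exponential growth for x > a survives it. *)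
Definition step_exponent a n := Num.truncn (a^-1 ^+ n / n%:R).

(* Approximates the indicator of x <= a on [0, 1]: the exponent is tuned so
   that N x^n tends to 0 for x <= a and to infinity for x > a. *)
Definition step_poly a n : {poly R} := (1 - 'X^n) ^+ step_exponent a n.

Lemma step_polyE a n x : (step_poly a n).[x] = (1 - x ^+ n) ^+ step_exponent a n.
Proof. by rewrite /step_poly horner_exp !hornerE. Qed.

Lemma step_poly_bound a n x : 0 <= x <= 1 -> 0 <= (step_poly a n).[x] <= 1.
Proof.
move=> /andP[x0 x1]; rewrite step_polyE.
have xn0 : 0 <= x ^+ n by rewrite exprn_ge0.
have xn1 : x ^+ n <= 1 by rewrite exprn_ile1.
by rewrite exprn_ge0 ?subr_ge0 //= exprn_ile1 ?subr_ge0 // gerBl.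
Qed.

Lemma cvg_step_poly a x : 0 < a -> 0 <= x <= 1 ->
  (fun n => (step_poly a n.+1).[x]) @ \oo --> ((x <= a)%R%:R : R).
Proof.
move=> a0 x01; have /andP[x0 x1] := x01.
have h n : (step_exponent a n.+1)%:R <= a^-1 ^+ n.+1 / n.+1%:R :> R.
  by rewrite truncn_le mulr_ge0 // exprn_ge0 // invr_ge0 ltW.
have xn n : 0 <= x ^+ n <= 1 by rewrite exprn_ge0 // exprn_ile1.
have [xa|ax] := leP x a.
  apply: (@squeeze_cvgr _ _ _ _ (fun n => 1 - n.+1%:R^-1) (fun=> 1)).
  - apply: nearW => n; have /andP[_ ->] := step_poly_bound a n.+1 x01; rewrite andbT.
    rewrite step_polyE; apply: le_trans (bernoulli_ge _ (xn _)).
    rewrite lerD2l lerN2; apply: le_trans (ler_wpM2r _ (h n)) _; first by case/andP: (xn n.+1).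
    rewrite mulrAC -exprMn -[leRHS]mul1r ler_wpM2r // exprn_ile1 //.
      by rewrite mulr_ge0 // invr_ge0 ltW.
    by rewrite mulrC ler_pdivrMr // mul1r.
  - rewrite -[X in _ --> X]subr0; apply: cvgB; first exact: cvg_cst.
    exact: cvg_harmonic.
  - exact: cvg_cst.
have r1 : 1 < x / a by rewrite ltr_pdivlMr // mul1r.
have l0 : 0 < ln (x / a) by rewrite ln_gt0.
apply: (@squeeze_cvgr _ _ _ _ (fun=> 0) (fun n => 2 / ln (x / a) ^+ 2 * n.+1%:R^-1)).
- apply: nearW => n; have /andP[-> _] := step_poly_bound a n.+1 x01.
  rewrite step_polyE /=; set N := step_exponent _ _.
  have N1 : (x / a) ^+ n.+1 / n.+1%:R <= 1 + N%:R * x ^+ n.+1.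
    have H0 : a^-1 ^+ n.+1 / n.+1%:R <= N%:R + 1.
      by rewrite natr1 ltW // truncnS_gt.
    have xn0 : 0 <= x ^+ n.+1 by case/andP: (xn n.+1).
    have := ler_wpM2r xn0 H0; rewrite mulrAC -exprMn [a^-1 * x]mulrC => H.
    apply: le_trans H _.
    by rewrite mulrDl mul1r addrC lerD2r; case/andP: (xn n.+1).
  have r0 : 0 < (x / a) ^+ n.+1 by rewrite exprn_gt0 // (lt_trans _ r1).
  (* The quadratic term of the exponential series is used because (x/a)^n gets divided by n; a
     linear lower bound would only stay bounded. *)
  have E : (n.+1%:R * ln (x / a)) ^+ 2 / 2 <= (x / a) ^+ n.+1.
    rewrite -[in leRHS](@lnK _ (x / a)) ?posrE ?(lt_trans _ r1) // -expRM_natl.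
    apply: le_trans (@expR_ge1Dxn _ _ 1 _).
      by rewrite lerDr.
    by rewrite mulr_ge0 // ltW.
  have Q : n.+1%:R * ln (x / a) ^+ 2 / 2 <= 1 + N%:R * x ^+ n.+1.
    apply: le_trans N1; rewrite ler_pdivlMr //; apply: le_trans E.
    by rewrite exprMn; lra.
  have q0 : 0 < n.+1%:R * ln (x / a) ^+ 2 / 2 by rewrite divr_gt0 // mulr_gt0 // exprn_gt0.
  rewrite [leRHS](_ : _ = (n.+1%:R * ln (x / a) ^+ 2 / 2)^-1); last first.
    by rewrite !invfM invrK; ring.
  rewrite -[leRHS]mul1r ler_pdivlMr //; apply: le_trans (bernoulli_le N (xn n.+1)).
  by apply: ler_wpM2l => //; rewrite exprn_ge0 // subr_ge0; case/andP: (xn n.+1).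
- exact: cvg_cst.
- rewrite -[X in _ --> X](mulr0 (2 / ln (x / a) ^+ 2)); apply: cvgM; first exact: cvg_cst.
  exact: cvg_harmonic.
Qed.

End StepPolynomials.

(** * Integrable means, and the Hausdorff moment problem for signed densities *)

Section Expectations.
Context {d : measure_display} {T : measurableType d} {R : realType}.
Variable P : probability T R.
Implicit Types (f g : T -> R) (l : R).

Definition has_mean f l : Prop :=
  P.-integrable setT (EFin \o f) /\ (\int[P]_w (f w)%:E = l%:E)%E.

Lemma has_mean_integral f : P.-integrable setT (EFin \o f) ->
  has_mean f (fine (\int[P]_w (f w)%:E)).
Proof. by move=> fi; split=> //; rewrite fineK // integrable_fin_num. Qed.

Lemma has_mean_measurable f l : has_mean f l -> measurable_fun setT f.
Proof. by move=> [/measurable_int/measurable_EFinP]. Qed.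

Lemma eq_has_mean f g l : f =1 g -> has_mean f l -> has_mean g l.
Proof. by move=> /funext ->. Qed.

Lemma has_meanD f g l l' : has_mean f l -> has_mean g l' ->
  has_mean (fun w => f w + g w) (l + l').
Proof.
move=> [fi fE] [gi gE]; split; first exact: integrableD fi gi.
by have := integralD_EFin measurableT fi gi; rewrite /= fE gE; exact.
Qed.

Lemma has_meanZ k f l : has_mean f l -> has_mean (fun w => k * f w) (k * l).
Proof.
move=> [fi fE]; split; first exact: (integrableZl measurableT k fi).
by have := integralZl measurableT fi k; rewrite /= fE; exact.
Qed.

Lemma has_meanB f g l l' : has_mean f l -> has_mean g l' ->
  has_mean (fun w => f w - g w) (l - l').
Proof.
move=> hf /(has_meanZ (-1)) hg; rewrite -[- l']mulN1r.
by apply: eq_has_mean (has_meanD hf hg) => w; rewrite mulN1r.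
Qed.

Lemma has_mean_cst k : has_mean (fun=> k) k.
Proof.
split; first exact: finite_measure_integrable_cst.
by rewrite integral_cst // [X in (_ * X)%E]probability_setT mule1.
Qed.

Lemma has_mean_sum (I : Type) (s : seq I) (F : I -> T -> R) (L : I -> R) :
  (forall i, has_mean (F i) (L i)) ->
  has_mean (fun w => \sum_(i <- s) F i w) (\sum_(i <- s) L i).
Proof.
move=> h; elim: s => [|i s IH].
  rewrite big_nil; apply: eq_has_mean (has_mean_cst 0) => w; by rewrite big_nil.
by rewrite big_cons; apply: eq_has_mean (has_meanD (h i) IH) => w; rewrite big_cons.
Qed.

Lemma has_mean_cvg (f_ : nat -> T -> R) (l_ : nat -> R) f g l :
  measurable_fun setT f -> (forall n, has_mean (f_ n) (l_ n)) ->
  (forall w, f_ ^~ w @ \oo --> f w) ->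
  P.-integrable setT (EFin \o g) -> (forall n w, `|f_ n w| <= g w) ->
  l_ @ \oo --> l -> has_mean f l.
Proof.
move=> mf hf_ cf gi fg cl.
have [] := @dominated_convergence _ _ _ P setT measurableT
  (fun n => EFin \o f_ n) (EFin \o f) (EFin \o g).
- by move=> n; apply/measurable_EFinP; exact: has_mean_measurable (hf_ n).
- exact/measurable_EFinP.
- by apply: aeW => w _; apply/cvg_EFin; [exact: nearW|exact: cf].
- exact: gi.
- by apply: aeW => w n _ /=; rewrite lee_fin.
move=> fi _ c; split => //.
have E n : (\int[P]_w (f_ n w)%:E = (l_ n)%:E)%E by case: (hf_ n).
have : (fun n => (l_ n)%:E) @ \oo --> l%:E by apply/cvg_EFin => //; exact: nearW.
rewrite [X in X @ _](_ : _ = (fun n => \int[P]_w (f_ n w)%:E)%E); last exact/funext.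
by move=> c'; exact: cvg_unique c c'.
Qed.

Definition same_mean f g := exists l, has_mean f l /\ has_mean g l.

Lemma same_mean_ext f f' g g' : f =1 f' -> g =1 g' ->
  same_mean f g -> same_mean f' g'.
Proof. by move=> /funext -> /funext ->. Qed.

Lemma same_meanZ k f g : same_mean f g ->
  same_mean (fun w => k * f w) (fun w => k * g w).
Proof. by move=> [l [hf hg]]; exists (k * l); split; apply: has_meanZ. Qed.

Lemma same_mean_sum (I : Type) (s : seq I) (F G : I -> T -> R) :
  (forall i, same_mean (F i) (G i)) ->
  same_mean (fun w => \sum_(i <- s) F i w) (fun w => \sum_(i <- s) G i w).
Proof.
move=> h; exists (\sum_(i <- s) sval (cid (h i))).
by split; apply: has_mean_sum => i; case: cid => l [].
Qed.

Lemma same_mean_poly (h1 h2 v1 v2 : T -> R) (p : {poly R}) :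
  (forall n, same_mean (fun w => h1 w * v1 w ^+ n) (fun w => h2 w * v2 w ^+ n)) ->
  same_mean (fun w => h1 w * p.[v1 w]) (fun w => h2 w * p.[v2 w]).
Proof.
move=> h; have := same_mean_sum (index_enum 'I_(size p))
  (fun i : 'I_(size p) => same_meanZ p`_i (h i)).
by apply: same_mean_ext => w; rewrite horner_coef mulr_sumr;
  apply: eq_bigr => i _; ring.
Qed.

(** Values of [v] outside the unit interval are tolerated where the density vanishes, so that
    indicators can be absorbed into [h]. *)
Let supported01 (h v : T -> R) := forall w, h w != 0 -> 0 <= v w <= 1.

Lemma measurable_le_indicator (v : T -> R) (a : R) : measurable_fun setT v ->
  measurable_fun setT (fun w => (v w <= a)%R%:R : R).
Proof.
move=> mv; rewrite (_ : (fun _ => _) = \1_(v @^-1` [set` `]-oo, a]])).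
  apply: measurable_indic; rewrite -[X in measurable X]setTI; exact: mv.
apply/funext => w; rewrite indicE; congr (nat_of_bool _)%:R.
by apply/idP/idP; rewrite inE /= in_itv.
Qed.

(** Equal moments give equal integrals of all step polynomials; these are bounded by 1 where the
    density is nonzero, so |h| dominates and the integrals converge to those over v <= a. *)
Lemma same_mean_step (h1 h2 v1 v2 : T -> R) (a : R) : 0 < a ->
  measurable_fun setT v1 -> measurable_fun setT v2 ->
  supported01 h1 v1 -> supported01 h2 v2 ->
  (forall n, same_mean (fun w => h1 w * v1 w ^+ n) (fun w => h2 w * v2 w ^+ n)) ->
  same_mean (fun w => h1 w * (v1 w <= a)%R%:R) (fun w => h2 w * (v2 w <= a)%R%:R).
Proof.
move=> a0 mv1 mv2 s1 s2 h.
have hp n := same_mean_poly (step_poly a n.+1) h.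
have h0 : same_mean h1 h2.
  by apply: same_mean_ext (h 0) => w; rewrite expr0 mulr1.
pose l n := sval (cid (hp n)).
(* Stated once for both sides, with the common values [l n]: both integrals are limits of the same
   sequence. *)
have key (g v : T -> R) : measurable_fun setT v -> supported01 g v ->
    P.-integrable setT (EFin \o g) ->
    (forall n, has_mean (fun w => g w * (step_poly a n.+1).[v w]) (l n)) ->
    [/\ P.-integrable setT (EFin \o (fun w => g w * (v w <= a)%R%:R)) &
    (fun n => (l n)%:E) @ \oo --> (\int[P]_w (g w * (v w <= a)%R%:R)%:E)%E].
  move=> mv s hi hl.
  have mh : measurable_fun setT g by case/integrableP: hi => /measurable_EFinP.
  have [] := @dominated_convergence _ _ _ P setT measurableT
    (fun n => EFin \o (fun w => g w * (step_poly a n.+1).[v w]))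
    (EFin \o (fun w => g w * (v w <= a)%R%:R)) (EFin \o (fun w => `|g w|%R)).
  - by move=> n; apply/measurable_EFinP; exact: has_mean_measurable (hl n).
  - apply/measurable_EFinP/measurable_funM => //; exact: measurable_le_indicator.
  - apply: aeW => w _.
    suff c : (fun n => g w * (step_poly a n.+1).[v w]) @ \oo --> g w * (v w <= a)%R%:R.
      by apply/cvg_EFin; [exact: nearW|exact: c].
    have [->|hw] := eqVneq (g w) 0.
      rewrite mul0r [X in X @ _](_ : _ = fun=> 0); first exact: cvg_cst.
      by apply/funext => n; rewrite mul0r.
    by apply: cvgM; [exact: cvg_cst|exact: cvg_step_poly (s w hw)].
  - exact: integrable_norm.
  - apply: aeW => w n _ /=; rewrite lee_fin normrM.
    have [->|hw] := eqVneq (g w) 0; first by rewrite normr0 mul0r.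
    have /andP[p0 p1] := step_poly_bound a n.+1 (s w hw).
    by rewrite (ger0_norm p0) ler_piMr.
  move=> hi' _ c; split => //.
  rewrite [X in X @ _](_ : _ =
     (fun n => \int[P]_w (g w * (step_poly a n.+1).[v w])%:E)%E) //.
  by apply/funext => n; case: (hl n).
have [l0 [[i1 _] [i2 _]]] := h0.
have [j1 c1] : _ := key _ _ mv1 s1 i1 (fun n => proj1 (svalP (cid (hp n)))).
have [j2 c2] : _ := key _ _ mv2 s2 i2 (fun n => proj2 (svalP (cid (hp n)))).
have E := cvg_unique _ c1 c2.
have H1 := has_mean_integral j1; have H2 := has_mean_integral j2.
by exists (fine (\int[P]_w (h1 w * (v1 w <= a)%R%:R)%:E)); split => //; rewrite E.
Qed.

(** Induction on the number of coordinates. With the other exponents fixed, their monomial joins the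
    density and [same_mean_step] replaces the power of the last coordinate by an indicator; that
    indicator then joins the density in the induction hypothesis. *)
Lemma same_mean_box (k : nat) (h1 h2 : T -> R) (v1 v2 : nat -> T -> R)
    (a : nat -> R) :
  (forall i, 0 < a i) ->
  (forall i, measurable_fun setT (v1 i)) -> (forall i, measurable_fun setT (v2 i)) ->
  (forall i, (i < k)%N -> supported01 h1 (v1 i)) ->
  (forall i, (i < k)%N -> supported01 h2 (v2 i)) ->
  (forall n : nat -> nat,
     same_mean (fun w => h1 w * \prod_(i < k) v1 i w ^+ n i)
               (fun w => h2 w * \prod_(i < k) v2 i w ^+ n i)) ->
  same_mean (fun w => h1 w * \prod_(i < k) (v1 i w <= a i)%R%:R)
            (fun w => h2 w * \prod_(i < k) (v2 i w <= a i)%R%:R).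
Proof.
move=> a0 mv1 mv2; elim: k h1 h2 => [|k IH] h1 h2 s1 s2 h.
  apply: same_mean_ext (h (fun=> 0)) => w; by rewrite !big_ord0.
have := IH (fun w => h1 w * (v1 k w <= a k)%R%:R)
           (fun w => h2 w * (v2 k w <= a k)%R%:R).
move=> /(_ _ _ _)/cid[|||l hl].
- by move=> i ik w; apply: contraNP => /negP /(contraNN (s1 i (ltnW ik) w)); rewrite negbK => /eqP ->; rewrite mul0r.
- by move=> i ik w; apply: contraNP => /negP /(contraNN (s2 i (ltnW ik) w)); rewrite negbK => /eqP ->; rewrite mul0r.
- move=> n; have := @same_mean_step (fun w => h1 w * \prod_(i < k) v1 i w ^+ n i)
    (fun w => h2 w * \prod_(i < k) v2 i w ^+ n i) (v1 k) (v2 k) (a k) (a0 k) (mv1 k) (mv2 k).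
  move=> /(_ _ _ _)/cid[|||l hl].
  + by move=> w; apply: contraNP => /negP /(contraNN (s1 k (ltnSn k) w)); rewrite negbK => /eqP ->; rewrite mul0r.
  + by move=> w; apply: contraNP => /negP /(contraNN (s2 k (ltnSn k) w)); rewrite negbK => /eqP ->; rewrite mul0r.
  + move=> m; apply: same_mean_ext (h (fun i => if i == k then m else n i)) => w;
      rewrite big_ord_recr /= eqxx mulrA; congr (_ * _ * _);
      by apply: eq_bigr => i _; rewrite ltn_eqF.
  by apply: (same_mean_ext _ _ (ex_intro _ l hl)) => w; rewrite mulrAC.
by apply: (same_mean_ext _ _ (ex_intro _ l hl)) => w; rewrite big_ord_recr /= -mulrA [X in _ * X]mulrC.
Qed.

End Expectations.

(** * Exponential moments *)

Section DifferenceQuotients.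
Variable R : realType.
Implicit Types (f : R -> R) (l t x : R).

Lemma is_derive_cvg0 f l : is_derive (0 : R) (1 : R) f l ->
  (fun t => (f t - f 0) / t) @ 0^' --> l.
Proof.
move=> [fd <-]; have := fd; rewrite /derivable /derive => /cvg_ex[l' c].
have E := cvg_lim (@norm_hausdorff _ _) c; rewrite /= in E; rewrite E.
move: c; rewrite [X in X @ _](_ : _ = (fun t => (f t - f 0) / t)) //.
apply/funext => t /=; rewrite addr0 /GRing.scale /= mulr1; ring.
Qed.

Lemma cvg0_oppr f l : f @ 0^' --> l -> (fun t => f (- t)) @ 0^' --> l.
Proof.
move=> /cvgr_dnbhsP h; apply/cvgr_dnbhsP => u [u0 uc].
apply: (h (fun n => - u n)); split=> [n|]; first by rewrite oppr_eq0 u0.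
by rewrite -oppr0; exact: cvgN.
Qed.

Lemma is_derive_cvg_symmetric f l : is_derive (0 : R) (1 : R) f l ->
  (fun t => (f t - f (- t)) / (2 * t)) @ 0^' --> l.
Proof.
move=> /is_derive_cvg0 c; have c' := cvg0_oppr c.
rewrite [X in _ --> X](_ : _ = 2^-1 * (l + l)); last by field.
have {}c : 2^-1 * ((f t - f 0) / t + (f (- t) - f 0) / - t) @[t --> 0^'] --> 2^-1 * (l + l).
  by apply: cvgM; [exact: cvg_cst|exact: cvgD].
apply: cvg_trans c.
apply: near_eq_cvg; near=> t.
have t0 : t != 0 by near: t; exact: nbhs_dnbhs_neq.
by rewrite /=; field.
Unshelve. all: by end_near. Qed.

(** This is sinh(t x) / t, the symmetric difference quotient of exp(t x). Its square is the second
    difference of exp with step 2t, divided by (2t)^2, so one function serves both orders of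
    differentiation. *)
Definition sinhc t x := (expR (t * x) - expR (- (t * x))) / (2 * t).

Lemma cvg_sinhc x : (fun t => sinhc t x) @ 0^' --> x.
Proof.
have D : is_derive (0 : R) (1 : R) (fun t => expR (t * x)) x.
  have H : is_derive (0 : R) (1 : R) (fun t => t * x) x.
    by apply: is_derive_eq; rewrite /GRing.scale /= mulr0 add0r mulr1.
  apply: is_derive_eq; rewrite mul0r expR0 /GRing.scale /= ?mul1r //.
apply: cvg_trans (is_derive_cvg_symmetric D).
apply: near_eq_cvg; near=> t.
by rewrite /sinhc mulNr.
Unshelve. all: by end_near. Qed.

Lemma normr_expR_sub x : `|expR x - expR (- x)| <= 2 * `|x| * expR `|x|.
Proof.
wlog x0 : x / 0 <= x => [hw|].
  have [/hw//|/ltW x0] := leP 0 x.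
  by have := hw (- x); rewrite oppr_ge0 opprK normrN distrC; apply.
rewrite (ger0_norm x0) ger0_norm ?subr_ge0 ?ler_expR ?ge0_cp //.
have := expR_ge1Dx (- (2 * x)) => h.
have -> : expR (- x) = expR x * expR (- (2 * x)) by rewrite -expRD; congr expR; ring.
have e0 := expR_ge0 x; nra.
Qed.

Lemma normr_sinhc t x : t != 0 -> `|sinhc t x| <= `|x| * expR (`|t| * `|x|).
Proof.
move=> t0; rewrite /sinhc normrM normfV ler_pdivrMr ?normr_gt0 ?mulf_neq0 //.
apply: le_trans (normr_expR_sub _) _; rewrite !normrM (@ger0_norm _ 2) //.
by rewrite le_eqVlt; apply/orP; left; apply/eqP; ring.
Qed.

(** The factor 4: |x| <= e^-1 exp(e |x|) absorbs the linear factor and gives |sinhc| <= e^-1 exp(2 e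
    |x|); squaring doubles the exponent once more. The sum of two exponentials replaces exp of an
    absolute value. *)
Lemma sinhc_dominated e t x : 0 < e -> t != 0 -> `|t| <= e ->
  `|sinhc t x| <= e^-1 * (expR (4 * e * x) + expR (- (4 * e * x))) /\
  `|sinhc t x ^+ 2| <= e^-1 ^+ 2 * (expR (4 * e * x) + expR (- (4 * e * x))).
Proof.
move=> e0 t0 te; set y := e * `|x|.
have y0 : 0 <= y by rewrite mulr_ge0 // ltW.
have b1 : `|sinhc t x| <= e^-1 * expR (2 * y).
  apply: le_trans (normr_sinhc x t0) _.
  have h1 : `|x| <= e^-1 * expR y.
    rewrite -(ler_pM2l e0) mulrA mulfV ?gt_eqF // mul1r -/y.
    by apply: le_trans (expR_ge1Dx y); rewrite lerDr.
  have h2 : expR (`|t| * `|x|) <= expR y by rewrite ler_expR ler_wpM2r.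
  have -> : expR (2 * y) = expR y * expR y by rewrite -expRD; congr expR; ring.
  by rewrite mulrA ler_pM // expR_ge0.
have E : expR (4 * y) <= expR (4 * e * x) + expR (- (4 * e * x)).
  rewrite /y; have [x0|x0] := leP 0 x.
    by rewrite (ger0_norm x0) !mulrA lerDl expR_ge0.
  by rewrite (ltr0_norm x0) !mulrN !mulrA lerDr expR_ge0.
have E2 : expR (2 * y) <= expR (4 * y) by rewrite ler_expR ler_wpM2r // ler_nat.
split.
  apply: le_trans b1 _; rewrite ler_wpM2l ?invr_ge0 ?(ltW e0) //.
  exact: le_trans E2 E.
rewrite normrX; apply: (@le_trans _ _ ((e^-1 * expR (2 * y)) ^+ 2)).
  by rewrite ler_sqr ?nnegrE // mulr_ge0 ?expR_ge0 // invr_ge0 ltW.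
rewrite exprMn ler_wpM2l ?sqr_ge0 // expr2 -expRD; apply: le_trans E.
by rewrite ler_expR -mulrDl -natrD.
Qed.

End DifferenceQuotients.

Section ExponentialMoments.
Context {d : measure_display} {T : measurableType d} {R : realType}.
Variable P : probability T R.
Variables (U W : T -> R) (g : R -> R) (e : R).
Hypotheses (e0 : 0 < e) (mU : measurable_fun setT U) (mW : measurable_fun setT W).
Hypothesis hg : forall t, `|t| <= e ->
  has_mean P (fun w => expR (U w + t * W w)) (g t).

(** Step sizes tending to 0. The quarter turns the exponent [4 * (e / 4)] coming from
    [sinhc_dominated] into e, the edge of the window where [hg] provides integrability, and keeps
    the doubled step inside that window. *)
Let tau n : R := e / 4 / n.+1%:R.

Let tau_neq0 n : tau n != 0.
Proof. by rewrite gt_eqF // !divr_gt0. Qed.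

Let tau_le n : `|tau n| <= e / 4.
Proof.
have e4 : 0 <= e / 4 by rewrite divr_ge0 // ltW.
rewrite /tau ger0_norm; last by rewrite divr_ge0.
by rewrite ler_pdivrMr ?ltr0n // ler_peMr ?ler1n.
Qed.

Let cvg_tau : tau @ \oo --> (0 : R).
Proof.
rewrite -(mulr0 (e / 4)); apply: cvgM; first exact: cvg_cst.
exact: cvg_harmonic.
Qed.

Let dominant (C : R) :
  P.-integrable setT (EFin \o (fun w =>
    C * ((expR (U w + e * W w)) + expR (U w + (- e) * W w)))).
Proof.
have he : `|e| <= e by rewrite ger0_norm // ltW.
have hN : `|- e| <= e by rewrite normrN.
exact: (has_meanZ C (has_meanD (hg he) (hg hN))).1.
Qed.

Let dominantE w : expR (U w + e * W w) + expR (U w + - e * W w) =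
  expR (U w) * (expR (4 * (e / 4) * W w) + expR (- (4 * (e / 4) * W w))).
Proof. by rewrite !expRD mulrDr; congr (_ * expR _ + _ * expR _); field. Qed.

Let norm_tau_le t n : t = tau n \/ t = 2 * tau n -> `|t| <= e /\ `|- t| <= e.
Proof.
move=> h; rewrite normrN; suff : `|t| <= e by [].
have ht := tau_le n; have e0' := ltW e0; case: h => ->; first by lra.
by rewrite [X in X <= _]normrM normr_nat; lra.
Qed.

(** Differentiation under the integral sign along the sequence [tau]. Only the symmetric quotient of
    [g] has to converge, since that is the mean of [sinhc (tau n) W * expR U]. *)
Lemma has_mean_derive l :
  (fun t => (g t - g (- t)) / (2 * t)) @ 0^' --> l ->
  has_mean P (fun w => W w * expR (U w)) l.
Proof.
move=> /cvgr_dnbhsP /(_ tau (conj tau_neq0 cvg_tau)).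
apply: (@has_mean_cvg _ _ _ _ (fun n w => sinhc (tau n) (W w) * expR (U w)) _ _
  _ _ _ _ _ (dominant ((e / 4)^-1))).
- by apply: measurable_funM => //; exact: measurableT_comp.
- move=> n; have [h1 h2] := norm_tau_le (or_introl (erefl (tau n))).
  have := has_meanZ (2 * tau n)^-1 (has_meanB (hg h1) (hg h2)).
  rewrite [X in has_mean _ _ X]mulrC; apply: eq_has_mean => w.
  by rewrite /sinhc !expRD mulNr; ring.
- move=> w; apply: cvgM; last exact: cvg_cst.
  by have /cvgr_dnbhsP := @cvg_sinhc R (W w); apply.
- move=> n w; rewrite dominantE normrM (ger0_norm (expR_ge0 _)).
  have [h _] := sinhc_dominated (W w) (divr_gt0 e0 (ltr0n _ 4)) (tau_neq0 n) (tau_le n).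
  by rewrite [leRHS]mulrCA mulrC ler_wpM2l ?expR_ge0.
Qed.

Lemma has_mean_derive2 l :
  (fun t => (g t + g (- t) - 2 * g 0) / t ^+ 2) @ 0^' --> l ->
  has_mean P (fun w => W w ^+ 2 * expR (U w)) l.
Proof.
move=> /cvgr_dnbhsP c.
(* The step is doubled because [sinhc (tau n)] squared is a second difference of step
   [2 * tau n]. *)
have /c : (forall n, 2 * tau n != 0) /\ (fun n => 2 * tau n) @ \oo --> (0 : R).
  split=> [n|]; first by rewrite mulf_neq0.
  rewrite -[X in _ --> X](mulr0 2); apply: cvgM; [exact: cvg_cst|exact: cvg_tau].
apply: (@has_mean_cvg _ _ _ _ (fun n w => sinhc (tau n) (W w) ^+ 2 * expR (U w)) _ _
  _ _ _ _ _ (dominant ((e / 4)^-1 ^+ 2))).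
- by apply: measurable_funM; [exact: measurable_funX|exact: measurableT_comp].
- move=> n; have [h1 h2] := norm_tau_le (or_intror (erefl (2 * tau n))).
  have h0 : `|0 : R| <= e by rewrite normr0 ltW.
  have := has_meanZ ((2 * tau n) ^+ 2)^-1
    (has_meanB (has_meanD (hg h1) (hg h2)) (has_meanZ 2 (hg h0))).
  rewrite [X in has_mean _ _ X]mulrC; apply: eq_has_mean => w.
  rewrite /sinhc mul0r addr0 mulNr !expRD !expRN.
  have -> : expR (2 * tau n * W w) = expR (tau n * W w) ^+ 2.
    by rewrite expr2 -expRD; congr expR; ring.
  have t0 := tau_neq0 n; have e1 := expR_gt0 (tau n * W w).
  by field; rewrite t0 gt_eqF.
- move=> w; apply: cvgM; last exact: cvg_cst.
  by apply: cvgM; have /cvgr_dnbhsP := @cvg_sinhc R (W w); apply.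
- move=> n w; rewrite dominantE normrM (ger0_norm (expR_ge0 _)).
  have [_ h] := sinhc_dominated (W w) (divr_gt0 e0 (ltr0n _ 4)) (tau_neq0 n) (tau_le n).
  by rewrite [leRHS]mulrCA mulrC ler_wpM2l ?expR_ge0.
Qed.

End ExponentialMoments.

(** * Almost sure bounds and independence *)

Section AlmostSure.
Context {d : measure_display} {T : measurableType d} {R : realType}.
Variable P : probability T R.
Implicit Types f g : T -> R.

Lemma integrable_integral_ae f g (D : set T) : measurable D ->
  measurable_fun setT g -> {ae P, forall w, f w = g w} ->
  P.-integrable setT (EFin \o f) ->
  P.-integrable setT (EFin \o g) /\
  (\int[P]_(w in D) (f w)%:E = \int[P]_(w in D) (g w)%:E)%E.
Proof.
move=> mD mg fg fi.
have mf : measurable_fun setT f by have /measurable_int/measurable_EFinP := fi.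
split.
  apply/integrableP; split; first exact/measurable_EFinP.
  have /integrableP[_] := fi; apply: le_lt_trans.
  rewrite le_eqVlt; apply/orP; left; apply/eqP; apply: ae_eq_integral => //.
  - by apply: measurableT_comp => //; exact/measurable_EFinP.
  - by apply: measurableT_comp => //; exact/measurable_EFinP.
  - by apply: filterS fg => w /= -> _.
apply: ae_eq_integral => //.
- by apply: measurable_funS (measurableT) _ _ => //; exact/measurable_EFinP.
- by apply: measurable_funS (measurableT) _ _ => //; exact/measurable_EFinP.
- by apply: filterS fg => w /= -> _.
Qed.

Lemma has_mean_ae f g l : measurable_fun setT g -> {ae P, forall w, f w = g w} ->
  has_mean P f l -> has_mean P g l.
Proof.
move=> mg fg [fi fE].
by have [gi E] := integrable_integral_ae measurableT mg fg fi; split=> //; rewrite -E.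
Qed.

(* f^+ <= e^(n f) / n for every n, so f^+ has mean zero. *)
Lemma ae_le0 f : measurable_fun setT f ->
  (forall n : nat, exists l, l <= 1 /\ has_mean P (fun w => expR (n%:R * f w)) l) ->
  {ae P, forall w, f w <= 0}.
Proof.
move=> mf h; pose fp w := Num.max (f w) 0.
have mfp : measurable_fun setT fp by exact: measurable_maxr.
have fp0 w : 0 <= fp w by rewrite le_max lexx orbT.
have bound n w : n.+1%:R * fp w <= expR (n.+1%:R * f w).
  rewrite /fp; have [fw|fw] := leP (f w) 0; first by rewrite mulr0 expR_ge0.
  by apply: le_trans (expR_ge1Dx _); rewrite lerDr.
have int n : (\int[P]_w (fp w)%:E <= (n.+1%:R^-1)%:E)%E.
  have [l [l1 [li lE]]] := h n.+1.
  apply: (@le_trans _ _ (\int[P]_w (n.+1%:R^-1%:E * (expR (n.+1%:R * f w))%:E))%E).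
    apply: ge0_le_integral => //.
    - by move=> w _; rewrite lee_fin.
    - exact/measurable_EFinP.
    - by case/integrableP: (integrableZl measurableT n.+1%:R^-1 li).
    - move=> w _; rewrite -EFinM lee_fin -(ler_pM2l (ltr0n _ n.+1)) mulrA mulfV //.
      by rewrite mul1r.
  rewrite integralZl // lE -EFinM lee_fin -[leRHS]mulr1 ler_wpM2l //.
have int0 : (\int[P]_w (fp w)%:E = 0)%E.
  apply/eqP; rewrite eq_le integral_ge0 ?andbT; last by move=> w _; rewrite lee_fin.
  have c : (n.+1%:R^-1 : R)%:E @[n --> \oo] --> (0%R)%:E.
    by apply: cvg_EFin; [exact: nearW|exact: cvg_harmonic].
  by apply: (cvge_ge _ c); apply: nearW => n; exact: int.
have mfpE : measurable_fun setT (EFin \o fp) by exact/measurable_EFinP.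
have /(ae_eq_integral_abs P measurableT mfpE) : (\int[P]_w `|(EFin \o fp) w| = 0)%E.
  by rewrite -[RHS]int0; apply: eq_integral => w _ /=; rewrite ger0_norm.
apply: filterS => w /(_ I) [] /eqP; rewrite /fp => /eqP e.
by rewrite -e le_max lexx.
Qed.

End AlmostSure.

Section Independence.
Context {d : measure_display} {T : measurableType d} {R : realType}.
Variable P : probability T R.
Context {d' : measure_display} {E : measurableType d'}.
Variables (mu : probability E R).

Lemma has_law_integral (X : T -> E) (D : set E) (f : E -> R) :
  has_law P X mu -> measurable D -> measurable_fun setT f -> (forall x, 0 <= f x) ->
  (\int[P]_(w in X @^-1` D) (f (X w))%:E = \int[mu]_(x in D) (f x)%:E)%E.
Proof.
move=> [mX lX] mD mf f0.
rewrite -(@eq_measure_integral _ _ _ D mu (pushforward P X)).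
  rewrite ge0_integral_pushforward //.
  - by apply: measurable_funTS; exact/measurable_EFinP.
  - by move=> x _; rewrite lee_fin.
by move=> A mA _; exact: lX.
Qed.

Lemma has_law_mean (X : T -> E) (f : E -> R) l : has_law P X mu ->
  (forall x, 0 <= f x) -> has_mean mu f l -> has_mean P (fun w => f (X w)) l.
Proof.
move=> lX f0 [fi fE].
have mf : measurable_fun setT f by have /measurable_int/measurable_EFinP := fi.
have e := has_law_integral lX measurableT mf f0.
rewrite preimage_setT fE in e; split => //.
apply/integrableP; split.
  by apply/measurable_EFinP; apply: measurableT_comp => //; case: lX.
rewrite (_ : (\int[P]_w _ = l%:E)%E) ?ltry // -[RHS]e; apply: eq_integral => w _ /=.
by rewrite ger0_norm.
Qed.

(** Nonnegativity permits Tonelli and yields integrability of the product together with its value;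
    the lemma is meant for exponentials. *)
Lemma independent_mean (X Y : T -> E) (f g : E -> R) a b :
  has_law P X mu -> has_law P Y mu -> independent P X Y ->
  (forall x, 0 <= f x) -> (forall x, 0 <= g x) ->
  has_mean mu f a -> has_mean mu g b ->
  has_mean P (fun w => f (X w) * g (Y w)) (a * b).
Proof.
move=> [mX lX] [mY lY] ind f0 g0 hf hg.
have mf := has_mean_measurable hf; have mg := has_mean_measurable hg.
pose XY w := (X w, Y w).
have mXY : measurable_fun setT XY by exact: measurable_fun_pair.
have mfg : measurable_fun setT (fun z : E * E => f z.1 * g z.2).
  by apply: measurable_funM; apply: measurableT_comp.
have e : (\int[P]_w (f (X w) * g (Y w))%:E = (a * b)%:E)%E.
  transitivity (\int[pushforward P XY]_z (f z.1 * g z.2)%:E)%E.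
    rewrite ge0_integral_pushforward // ?preimage_setT //.
    - exact/measurable_EFinP.
    - by move=> z _; rewrite lee_fin mulr_ge0.
  rewrite (@eq_measure_integral _ _ _ setT (mu \x mu)%E).
    rewrite fubini_tonelli1 //=.
    - rewrite /fubini_F /=.
      under eq_integral.
        move=> x _; under eq_integral do rewrite EFinM.
        rewrite ge0_integralZl_EFin //; last first.
        + exact/measurable_EFinP.
        + by move=> y _; rewrite lee_fin.
        rewrite (proj2 hg) -EFinM mulrC EFinM; over.
      by rewrite integralZl // ?(proj2 hf) -?EFinM 1?mulrC //; exact: (proj1 hf).
    - exact/measurable_EFinP.
    - by move=> z; rewrite lee_fin mulr_ge0.
  (* The joint law is the product measure because independence says that the two agree on
     rectangles. *)
  move=> A mA _; apply/esym; apply: product_measure_unique => // B C mB mC.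
  by transitivity (P (X @^-1` B) * P (Y @^-1` C))%E; [rewrite -ind|rewrite lX ?lY].
split => //; apply/integrableP; split.
  by apply/measurable_EFinP/measurable_funM; apply: measurableT_comp.
rewrite (_ : (\int[P]_w _ = (a * b)%:E)%E) ?ltry // -[RHS]e.
by apply: eq_integral => w _ /=; rewrite ger0_norm // mulr_ge0.
Qed.

End Independence.

(** * Symmetric differences of powers of quadratics *)

Section PowersOfQuadratics.
Variable R : realType.
Implicit Types (a b c r s t : R).

Definition quad a b c t := a + b * t + c * t ^+ 2.

Lemma quad0 a b c : quad a b c 0 = a.
Proof. by rewrite /quad mulr0 expr0n mulr0 !addr0. Qed.

Lemma cvg_quad a b c : (fun t => quad a b c t) @ 0^' --> a.
Proof.
apply: cvg_within_filter.
have h : quad a b c t @[t --> (0 : R)] --> quad a b c 0.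
  apply: cvgD; [apply: cvgD; [exact: cvg_cst|apply: cvgM => //; exact: cvg_cst]|].
  by apply: cvgM; [exact: cvg_cst|exact: exprn_continuous].
by rewrite quad0 in h.
Qed.

Lemma is_derive_quad_powR a b c r : 0 < a ->
  is_derive (0 : R) (1 : R) (fun t => quad a b c t `^ r) (r * b * a `^ (r - 1)).
Proof.
move=> a0.
have H : is_derive (0 : R) (1 : R) (fun t => quad a b c t) b.
  by rewrite /quad; apply: is_derive_eq; rewrite /GRing.scale /=; ring.
have H2 : is_derive (quad a b c 0) 1 (powR (R:=R) ^~ r) (r * a `^ (r - 1)).
  by rewrite quad0; exact: is_derive1_powR.
have -> : r * b * a `^ (r - 1) = (r * a `^ (r - 1)) * b by ring.
exact: (is_derive1_comp H2 H).
Qed.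

Lemma cvg0_sqr (f : R -> R) (l : R) : f @ 0^' --> l ->
  (fun t => f (t ^+ 2)) @ 0^' --> l.
Proof.
move=> /cvgr_dnbhsP h; apply/cvgr_dnbhsP => u [u0 uc].
apply: (h (fun n => u n ^+ 2)); split=> [n|]; first by rewrite expf_neq0 // u0.
have -> : (0 : R) = 0 * 0 by rewrite mulr0.
exact: cvgM.
Qed.

Lemma quadN a b c t : quad a b c t * quad a b c (- t) =
  quad (a ^+ 2) (2 * a * c - b ^+ 2) (c ^+ 2) (t ^+ 2).
Proof. by rewrite /quad; ring. Qed.

Lemma powR_sqr a r : 0 < a -> (a ^+ 2) `^ r = a `^ (2 * r).
Proof. by move=> a0; rewrite -powR_mulrn ?ltW // -powRrM. Qed.

(** The product is even in t, hence by [quadN] a quadratic in t^2, and this second-order quotient is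
    just a first derivative in the variable t^2 at 0. *)
Lemma cvg_quad_product a b c r : 0 < a ->
  (fun t => ((quad a b c t * quad a b c (- t)) `^ (- r) - (a * a) `^ (- r)) / t ^+ 2)
    @ 0^' --> - r * (2 * a * c - b ^+ 2) * a `^ (- (2 * r) - 2).
Proof.
move=> a0; have a20 : 0 < a ^+ 2 by rewrite exprn_gt0.
have := cvg0_sqr (is_derive_cvg0
  (is_derive_quad_powR (2 * a * c - b ^+ 2) (c ^+ 2) (- r) a20)).
rewrite powR_sqr // (_ : 2 * (- r - 1) = - (2 * r) - 2); last by ring.
by under eq_fun do rewrite -quadN quad0 expr2.
Qed.

Lemma cvg_quad_product_second a b c r : 0 < a ->
  (fun t => ((quad a b c t * quad a b c (- t)) `^ (- r)
    + (quad a b c (- t) * quad a b c (- - t)) `^ (- r)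
    - 2 * (quad a b c 0 * quad a b c (- 0)) `^ (- r)) / t ^+ 2)
    @ 0^' --> 2 * (- r * (2 * a * c - b ^+ 2) * a `^ (- (2 * r) - 2)).
Proof.
move=> a0; rewrite [X in X @ _](_ : _ = fun t => 2 *
  (((quad a b c t * quad a b c (- t)) `^ (- r) - (a * a) `^ (- r)) / t ^+ 2)).
  by apply: cvgM; [exact: cvg_cst|exact: cvg_quad_product].
by apply/funext => t; rewrite oppr0 quad0 opprK [X in _ + X `^ _]mulrC; ring.
Qed.

(** Write the power as f^2 with f = quad^(-r/2). Then f(t)^2 + f(-t)^2 - 2 f(0)^2 = (f(t) - f(-t))^2
    + 2 (f(t) f(-t) - f(0)^2), which reduces the limit to the symmetric first derivative and to
    [cvg_quad_product]. *)
Lemma cvg_quad_second a b c r : 0 < a ->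
  (fun t => (quad a b c t `^ (- r) + quad a b c (- t) `^ (- r)
     - 2 * quad a b c 0 `^ (- r)) / t ^+ 2)
    @ 0^' --> (r * (r + 1) * b ^+ 2 - 2 * r * a * c) * a `^ (- r - 2).
Proof.
move=> a0; pose h := r / 2.
have c1 := is_derive_cvg_symmetric (is_derive_quad_powR b c (- h) a0).
have c2 := @cvg_quad_product a b c h a0.
have -> : (r * (r + 1) * b ^+ 2 - 2 * r * a * c) * a `^ (- r - 2) =
    4 * ((- h * b * a `^ (- h - 1)) * (- h * b * a `^ (- h - 1))) +
    2 * (- h * (2 * a * c - b ^+ 2) * a `^ (- (2 * h) - 2)).
  have -> : - (2 * h) - 2 = - r - 2 by rewrite /h; field.
  have -> : a `^ (- r - 2) = a `^ (- h - 1) * a `^ (- h - 1).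
    rewrite -powRD; first by congr (_ `^ _); rewrite /h; field.
    by rewrite (gt_eqF a0) implybT.
  by rewrite /h; field.
set u := (fun t => _ / (2 * t)) in c1; set v := (fun t => _ / t ^+ 2) in c2.
have c3 : 4 * (u t * u t) + 2 * v t @[t --> 0^'] -->
    4 * ((- h * b * a `^ (- h - 1)) * (- h * b * a `^ (- h - 1))) +
    2 * (- h * (2 * a * c - b ^+ 2) * a `^ (- (2 * h) - 2)).
  by apply: cvgD; apply: cvgM; try exact: cvg_cst; [exact: cvgM|exact: c2].
apply: cvg_trans c3; apply: near_eq_cvg; near=> t.
have t0 : t != 0 by near: t; exact: nbhs_dnbhs_neq.
have q1 : 0 < quad a b c t.
  by near: t; exact: (cvgr_gt a (@cvg_quad a b c)).
have q2 : 0 < quad a b c (- t).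
  by near: t; exact: (cvgr_gt a (cvg0_oppr (@cvg_quad a b c))).
have E x : 0 < x -> x `^ (- r) = x `^ (- h) * x `^ (- h).
  move=> x0; rewrite -powRD; first by congr (_ `^ _); rewrite /h; field.
  by rewrite (gt_eqF x0) implybT.
rewrite /u /v !powRM ?ltW // quad0 !E //.
by field.
Unshelve. all: by end_near. Qed.

End PowersOfQuadratics.

(** * Coordinates on Hermitian matrices *)

Section HermitianCoordinates.
Context {R : realType} {b : dyson}.
Implicit Types (x y v : herm R b) (s t : R).

Definition hdiag0 x : R := hRe (x 0 0).
Definition hdiag1 x : R := hRe (x 1 1).
Definition hoff x (r : 'I_b) : R := hcoord (x 0 1) 0 r.

Lemma herm_adj x i j : x i j = hconj (x j i).
Proof. by have /eqP/matrixP/(_ i j) := hermP x; rewrite !mxE. Qed.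

Lemma herm_diag x i : x i i = hreal b (hRe (x i i)).
Proof.
have := herm_adj x i i; case: x => M _ /=; move: (M i i); clear.
case: b => //= -[].
- by move=> a c /eqP; rewrite eq_complex /= eqxx /= => /eqP h; congr Complex; lra.
- by move=> a1 a2 a3 a4 [h1 h2 h3]; congr Quat; lra.
Qed.

Lemma of_hcoordK : cancel (@of_hcoord R b) (@hcoord R b).
Proof.
move=> v; apply/rowP => r; move: v r; case: b => /= v [r hr];
  rewrite !mxE /=.
- by case: r hr => // hr; congr (v _ _); apply/val_inj.
- by case: r hr => [|[|//]] hr /=; congr (v _ _); apply/val_inj.
- by case: r hr => [|[|[|[|//]]]] hr /=; congr (v _ _); apply/val_inj; rewrite /= ?inordK.
Qed.

Lemma hcoordD (z w : hring R b) : hcoord (z + w) = hcoord z + hcoord w.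
Proof.
apply/rowP; move: z w; case: b => /= z w r; rewrite !mxE //.
- by case: r => -[|[|//]] hr /=; case: z w => ? ? [].
- by case: r => -[|[|[|[|//]]]] hr.
Qed.

Lemma hcoordZ s (z : hring R b) : hcoord (hreal b s * z) = s *: hcoord z.
Proof.
apply/rowP; move: z; case: b => /= z r; rewrite !mxE //.
- by case: r => -[|[|//]] hr /=; case: z => ? ? /=; ring.
- by case: r => -[|[|[|[|//]]]] hr /=; ring.
Qed.

Lemma hReD (z w : hring R b) : hRe (z + w) = hRe z + hRe w.
Proof. by move: z w; case: b => // -[? ?] []. Qed.

Lemma hReZ s (z : hring R b) : hRe (hreal b s * z) = s * hRe z.
Proof. by move: z; case: b => //= -[] *; rewrite /=; ring. Qed.

Lemma hRe_real s : hRe (hreal b s) = s.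
Proof. by case: b. Qed.

Lemma ord2P (k : 'I_2) : k = 0 \/ k = 1.
Proof. by case: k => -[|[|//]] hk; [left|right]; exact: val_inj. Qed.

Definition herm_of_mx (a c : R) (w : 'rV[R]_b) : 'M[hring R b]_2 :=
  \matrix_(i, j) if i == 0 then (if j == 0 then hreal b a else of_hcoord w)
                 else (if j == 0 then hconj (of_hcoord w) else hreal b c).

Lemma herm_of_subproof a c w : herm_of_mx a c w \in @is_herm R b.
Proof.
apply/eqP/matrixP => i j; rewrite !mxE.
by case: (i == 0); case: (j == 0); rewrite ?hconj_real ?hconjK.
Qed.

Definition herm_of a c w : herm R b := Herm (herm_of_subproof a c w).

Lemma hdiag0_of a c w : hdiag0 (herm_of a c w) = a.
Proof. by rewrite /hdiag0 /= mxE /= hRe_real. Qed.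
Lemma hdiag1_of a c w : hdiag1 (herm_of a c w) = c.
Proof. by rewrite /hdiag1 /= mxE /= hRe_real. Qed.
Lemma hoff_of a c w r : hoff (herm_of a c w) r = w 0 r.
Proof. by rewrite /hoff /= mxE /= of_hcoordK. Qed.

Lemma hdiag0D x y : hdiag0 (x + y) = hdiag0 x + hdiag0 y.
Proof. by rewrite /hdiag0 /= mxE hReD. Qed.
Lemma hdiag1D x y : hdiag1 (x + y) = hdiag1 x + hdiag1 y.
Proof. by rewrite /hdiag1 /= mxE hReD. Qed.
Lemma hoffD x y r : hoff (x + y) r = hoff x r + hoff y r.
Proof. by rewrite /hoff /= mxE hcoordD mxE. Qed.
Lemma hdiag0Z s x : hdiag0 (s *: x) = s * hdiag0 x.
Proof. by rewrite /hdiag0 /= mxE hReZ. Qed.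
Lemma hdiag1Z s x : hdiag1 (s *: x) = s * hdiag1 x.
Proof. by rewrite /hdiag1 /= mxE hReZ. Qed.
Lemma hoffZ s x r : hoff (s *: x) r = s * hoff x r.
Proof. by rewrite /hoff /= mxE hcoordZ mxE. Qed.

Lemma hinnerE x y : hinner x y =
  hdiag0 x * hdiag0 y + hdiag1 x * hdiag1 y + 2 * \sum_(r < b) hoff x r * hoff y r.
Proof.
rewrite /hinner /mxtrace !big_ord_recl big_ord0 addr0 !mxE !big_ord_recl !big_ord0 !addr0.
have -> : lift ord0 ord0 = 1 :> 'I_2 by apply/val_inj.
rewrite (herm_diag x 0) (herm_diag x 1) (herm_adj x 1 0) (herm_adj y 1 0) !hReD !hReZ.
rewrite -/(hdiag0 x) -/(hdiag1 x) -/(hdiag0 y) -/(hdiag1 y) /hoff.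
rewrite -[x ord0 1]/(x 0 1) -[y ord0 1]/(y 0 1).
suff h : hRe (x 0 1 * hconj (y 0 1)) + hRe (hconj (x 0 1) * y 0 1) =
    2 * \sum_(r < b) hcoord (x 0 1) 0 r * hcoord (y 0 1) 0 r by lra.
move: (x 0 1) (y 0 1); clear; case: b => /= z w;
  rewrite !big_ord_recl !big_ord0 !mxE /=.
- by ring.
- by case: z w => ? ? [? ?] /=; ring.
- by ring.
Qed.

Lemma htrE x : htr x = hdiag0 x + hdiag1 x.
Proof.
rewrite /htr /mxtrace !big_ord_recl big_ord0 addr0 hReD.
by have -> : lift ord0 ord0 = 1 :> 'I_2 by apply/val_inj.
Qed.

Lemma hdetE x : hdet x = hdiag0 x * hdiag1 x - \sum_(r < b) hoff x r ^+ 2.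
Proof. by []. Qed.

Lemma hinnerC x y : hinner x y = hinner y x.
Proof.
rewrite !hinnerE mulrC [hdiag1 x * _]mulrC; congr (_ + 2 * _).
by apply: eq_bigr => r _; rewrite mulrC.
Qed.

Lemma hinnerDr x y v : hinner x (y + v) = hinner x y + hinner x v.
Proof.
rewrite !hinnerE hdiag0D hdiag1D.
under eq_bigr do rewrite hoffD mulrDr.
by rewrite big_split /=; ring.
Qed.

Lemma hinnerZr s x y : hinner x (s *: y) = s * hinner x y.
Proof.
rewrite !hinnerE hdiag0Z hdiag1Z.
under eq_bigr do rewrite hoffZ mulrCA.
by rewrite -mulr_sumr; ring.
Qed.

Lemma hinnerDl x y v : hinner (x + y) v = hinner x v + hinner y v.
Proof. by rewrite hinnerC hinnerDr !(hinnerC v). Qed.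
Lemma hinnerZl s x y : hinner (s *: x) y = s * hinner x y.
Proof. by rewrite hinnerC hinnerZr hinnerC. Qed.
Lemma hinnerNr x y : hinner x (- y) = - hinner x y.
Proof. by rewrite -scaleN1r hinnerZr mulN1r. Qed.
Lemma hinnerNl x y : hinner (- x) y = - hinner x y.
Proof. by rewrite hinnerC hinnerNr hinnerC. Qed.
Lemma hinner0l x : hinner 0 x = 0.
Proof. by rewrite -(scale0r (0 : herm R b)) hinnerZl mul0r. Qed.

(** A Lorentz form s_0^2 - s_1^2 - ... of signature (1, beta+1), with s_0 = sqrt(1+beta) tr v, s_1
    the difference of the diagonal entries and the other s_r twice the off-diagonal coordinates. *)
Definition gamma_form v : R := b%:R * htr v ^+ 2 + 4 * hdet v.

Definition gamma_polar x v : R := 2 * b%:R * htr x * htr v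
  + 4 * (hdiag0 x * hdiag1 v + hdiag1 x * hdiag0 v - 2 * \sum_(r < b) hoff x r * hoff v r).

Definition gamma_slope (c : R) x v : R :=
  gamma_polar x v - 2 * c * Num.sqrt (1 + b%:R) * htr v.

Lemma gamma_form_line x v t : gamma_form (x + t *: v) =
  gamma_form x + gamma_polar x v * t + gamma_form v * t ^+ 2.
Proof.
rewrite /gamma_form /gamma_polar !hdetE !htrE !hdiag0D !hdiag1D !hdiag0Z !hdiag1Z.
have -> : \sum_(r < b) hoff (x + t *: v) r ^+ 2 = \sum_(r < b) hoff x r ^+ 2 +
    2 * t * (\sum_(r < b) hoff x r * hoff v r) + t ^+ 2 * \sum_(r < b) hoff v r ^+ 2.
  rewrite !mulr_sumr -!big_split /=; apply: eq_bigr => r _.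
  by rewrite hoffD hoffZ; ring.
by ring.
Qed.

Lemma gamma_exprE c x :
  gamma_expr c x = 1 - 2 * c * Num.sqrt (1 + b%:R) * htr x + gamma_form x.
Proof. by rewrite /gamma_expr /gamma_form addrA. Qed.

Lemma htr_line x v t : htr (x + t *: v) = htr x + t * htr v.
Proof. by rewrite !htrE hdiag0D hdiag1D hdiag0Z hdiag1Z; ring. Qed.

Lemma gamma_expr_line c x v t : gamma_expr c (x + t *: v) =
  quad (gamma_expr c x) (gamma_slope c x v) (gamma_form v) t.
Proof. by rewrite !gamma_exprE gamma_form_line htr_line /quad /gamma_slope; ring. Qed.

Lemma hdiag0_0 : hdiag0 0 = 0. Proof. by rewrite -(scale0r 0) hdiag0Z mul0r. Qed.
Lemma hdiag1_0 : hdiag1 0 = 0. Proof. by rewrite -(scale0r 0) hdiag1Z mul0r. Qed.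
Lemma hoff_0 r : hoff 0 r = 0. Proof. by rewrite -(scale0r 0) hoffZ mul0r. Qed.

Lemma gamma_polar0 v : gamma_polar 0 v = 0.
Proof.
rewrite /gamma_polar htrE hdiag0_0 hdiag1_0 big1 => [|r _]; first by ring.
by rewrite hoff_0 mul0r.
Qed.

Lemma gamma_form0 : gamma_form 0 = 0.
Proof.
rewrite /gamma_form hdetE htrE hdiag0_0 hdiag1_0 big1 => [|r _]; first by ring.
by rewrite hoff_0 expr0n.
Qed.

Lemma gamma_expr0 c : gamma_expr c (0 : herm R b) = 1.
Proof. by rewrite gamma_exprE gamma_form0 htrE hdiag0_0 hdiag1_0; ring. Qed.

End HermitianCoordinates.

(** * Points of the domain of the Laplace transform *)

Section GammaDomain.
Context {R : realType} {b : dyson}.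
Implicit Types (x v : herm R b) (c t : R).

Lemma cvg_mx_entries (U : topologicalType) (I : Type) (F : set_system I)
    (FF : Filter F) m n (M : I -> 'M[U]_(m, n)) (N : 'M[U]_(m, n)) :
  (forall i j, (fun z => M z i j) @ F --> N i j) -> M @ F --> N.
Proof.
move=> h A [B hB BA]; rewrite /nbhs /=.
suff : F [set z | forall i j, B i j (M z i j)].
  by apply: filterS => z hz; exact: BA.
by apply: filter_forall => i; apply: filter_forall => j; exact: h (hB i j).
Qed.

Lemma continuous_herm_line x : continuous (fun t : R => t *: x).
Proof.
apply: (@continuous_comp_initial _ _ _ (@herm_coords R b)).
rewrite (_ : _ \o _ = fun t : R => \matrix_(i, j) (t *: hcoord (x i j))).
  move=> t; apply: cvg_mx_entries => i j; apply: cvg_mx_entries => k l.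
  rewrite !mxE; under eq_fun do rewrite !mxE.
  by apply: cvgM => //; exact: cvg_cst.
by apply/funext => t; apply/matrixP => i j; rewrite !mxE hcoordZ.
Qed.

(** The component of 0 is entered only along segments from 0, which are connected sets. *)
Lemma gamma_domain_segment c x :
  (forall t, 0 <= t <= 1 -> 0 < gamma_expr c (t *: x)) -> gamma_domain c x.
Proof.
move=> h; exists ((fun t : R => t *: x) @` `[0, 1]); last first.
  by exists 1; rewrite ?scale1r //= in_itv /= ler01 lexx.
split.
- by exists 0; rewrite ?scale0r //= in_itv /= ler01 lexx.
- by move=> _ [t ht <-]; apply: h; move: ht; rewrite /= in_itv.
apply: connected_continuous_connected; first exact: segment_connected.
exact/continuous_subspaceT/continuous_herm_line.
Qed.

Lemma gamma_formZ t x : gamma_form (t *: x) = t ^+ 2 * gamma_form x.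
Proof.
by rewrite -[t *: x]add0r gamma_form_line gamma_polar0 gamma_form0; ring.
Qed.

Lemma htrZ t x : htr (t *: x) = t * htr x.
Proof. by rewrite !htrE hdiag0Z hdiag1Z; ring. Qed.

(** Both inequalities are stable under multiplying x by t in [0, 1], the trace being homogeneous of
    degree 1 and the form of degree 2, and they leave [gamma_expr] at least 1 - 1/2 - 1/4 on the
    whole segment. *)
Lemma gamma_domain_sufficient c x : 1 < c ->
  2 * c * Num.sqrt (1 + b%:R) * htr x <= 2^-1 -> - 4^-1 <= gamma_form x ->
  gamma_domain c x /\ 0 < gamma_expr c x.
Proof.
move=> c1 h1 h2.
have h t : 0 <= t <= 1 -> 0 < gamma_expr c (t *: x).
  move=> /andP[t0 t1]; rewrite gamma_exprE gamma_formZ htrZ.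
  set u := _ * _ * _ * htr x in h1 *.
  have -> : 2 * c * Num.sqrt (1 + b%:R) * (t * htr x) = t * u by rewrite /u; ring.
  have t2 : t ^+ 2 <= 1 by rewrite expr_le1.
  have e1 : t * u <= 2^-1.
    apply: le_trans (ler_wpM2l t0 h1) _; rewrite -[leRHS]mul1r ler_wpM2r //.
  have e2 : - 4^-1 <= t ^+ 2 * gamma_form x.
    apply: le_trans (ler_wpM2l (sqr_ge0 t) h2); rewrite mulrN lerN2.
    by rewrite -[leRHS]mul1r ler_wpM2r.
  by lra.
split; first exact: gamma_domain_segment h.
by have := h 1; rewrite scale1r; apply; rewrite ler01 lexx.
Qed.

(* A polyhedral cone of positive matrices on whose opposite the Laplace
   transform is finite. *)
Definition diag_dominant x : Prop :=
  \sum_(r < b) `|hoff x r| <= hdiag0 x /\ \sum_(r < b) `|hoff x r| <= hdiag1 x.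

Lemma diag_dominant0 : diag_dominant 0.
Proof.
by split; rewrite ?hdiag0_0 ?hdiag1_0 big1 // => r _; rewrite hoff_0 normr0.
Qed.

Lemma diag_dominantD x y : diag_dominant x -> diag_dominant y -> diag_dominant (x + y).
Proof.
move=> [x0 x1] [y0 y1].
have h : \sum_(r < b) `|hoff (x + y) r| <=
    \sum_(r < b) `|hoff x r| + \sum_(r < b) `|hoff y r|.
  by rewrite -big_split /=; apply: ler_sum => r _; rewrite hoffD ler_normD.
by split; rewrite ?hdiag0D ?hdiag1D; apply: le_trans h _; exact: lerD.
Qed.

Lemma diag_dominantMn x n : diag_dominant x -> diag_dominant (x *+ n).
Proof.
move=> hx; elim: n => [|n IH]; first by rewrite mulr0n; exact: diag_dominant0.
by rewrite mulrS; exact: diag_dominantD.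
Qed.

Lemma sum_sqr_le_sqr_sum (I : Type) (s : seq I) (F : I -> R) :
  (forall i, 0 <= F i) -> \sum_(i <- s) F i ^+ 2 <= (\sum_(i <- s) F i) ^+ 2.
Proof.
move=> F0; elim: s => [|i s IH]; first by rewrite !big_nil expr0n.
rewrite !big_cons; have h : 0 <= \sum_(j <- s) F j by apply: sumr_ge0.
by have := F0 i; nra.
Qed.

Lemma diag_dominant_ge0 x : diag_dominant x -> 0 <= htr x /\ 0 <= gamma_form x.
Proof.
move=> [h0 h1]; set s := \sum_(r < b) _ in h0 h1.
have s0 : 0 <= s by apply: sumr_ge0.
have t0 : 0 <= htr x by rewrite htrE addr_ge0 // (le_trans s0).
split=> //; rewrite /gamma_form addr_ge0 //.
  by rewrite mulr_ge0 // sqr_ge0.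
rewrite mulr_ge0 // hdetE subr_ge0; apply: (@le_trans _ _ (s ^+ 2)).
  rewrite (eq_bigr (fun r => `|hoff x r| ^+ 2)) => [|r _]; last by rewrite real_normK ?num_real.
  exact: sum_sqr_le_sqr_sum.
by rewrite expr2 ler_pM.
Qed.

(** Provides the symmetric window in t that two-sided differentiation at -x along an arbitrary
    direction v requires. *)
Lemma gamma_domain_near c x v : 1 < c -> diag_dominant x ->
  exists2 e : R, 0 < e & forall t, `|t| <= e ->
    gamma_domain c (- x + t *: v) /\ 0 < gamma_expr c (- x + t *: v).
Proof.
move=> c1 hx; have [trx fx] := diag_dominant_ge0 hx.
have c0 : 0 < c by apply: lt_trans c1.
set k := 2 * c * Num.sqrt (1 + b%:R).
have k0 : 0 <= k by rewrite !mulr_ge0 ?sqrtr_ge0 // ltW.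
set q := gamma_polar (- x) v; set w := gamma_form v.
(* At -x the trace is nonpositive and the form nonnegative, so the bounds of
   [gamma_domain_sufficient] hold with slack 1/2 and 1/4. The weights 2 and 4 keep the perturbation
   within that slack when |t| D <= 1; the summand 1 gives |t| <= 1, so that t^2 <= |t|. *)
pose D := 1 + 2 * k * `|htr v| + 4 * `|q| + 4 * `|w|.
have kv : 0 <= k * `|htr v| by rewrite mulr_ge0.
have D1 : 1 <= D by rewrite /D; have := normr_ge0 q; have := normr_ge0 w; lra.
have D0 : 0 < D by apply: lt_le_trans D1.
exists D^-1; first by rewrite invr_gt0.
move=> t ht; have tD : `|t| * D <= 1 by rewrite -ler_pdivlMr // mul1r.
have t0 := normr_ge0 t.
have tq : 0 <= `|t| * `|q| by rewrite mulr_ge0.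
have tw : 0 <= `|t| * `|w| by rewrite mulr_ge0.
have tv : 0 <= `|t| * (k * `|htr v|) by rewrite mulr_ge0.
have t1 : `|t| <= 1 by apply: le_trans tD; rewrite ler_peMr.
apply: gamma_domain_sufficient => //.
  rewrite -/k htr_line -[- x]scaleN1r htrZ mulrDr.
  have h1 : k * (-1 * htr x) <= 0 by rewrite mulrCA mulN1r oppr_le0 mulr_ge0.
  have h2 : k * (t * htr v) <= `|t| * (k * `|htr v|).
    by rewrite mulrCA [leRHS]mulrCA [leLHS]mulrCA ler_wpM2l // -normrM ler_norm.
  by move: tD; rewrite /D; lra.
rewrite gamma_form_line -/q -/w -[- x]scaleN1r gamma_formZ sqrrN expr1n mul1r.
have h1 : - (`|t| * `|q|) <= q * t by rewrite lerNl mulrC -normrM -normrN ler_norm.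
have h2 : - (`|t| * `|w|) <= w * t ^+ 2.
  apply: (@le_trans _ _ (- (`|t| ^+ 2 * `|w|))).
    by rewrite lerN2 ler_wpM2r // expr2 ler_piMr.
  by rewrite lerNl -normrX mulrC -normrM -normrN ler_norm.
by move: tD; rewrite /D; lra.
Qed.

End GammaDomain.

(** * Coordinate functionals and measurability *)

Section MeasurableHermitian.
Context {R : realType} {b : dyson}.
Implicit Types (x v : herm R b).

(* The directions diag(1,0), diag(0,1) and 1 + (1/2) e_r off the diagonal span
   the space and lie in the cone; past index b.+1 the direction is 1. *)
Definition cone_dir (i : nat) : herm R b :=
  herm_of (i != 1)%:R (i != 0)%:R (\row_(r < b) ((i == r.+2)%:R / 2)).

Lemma cone_dir_dominant i : diag_dominant (cone_dir i).
Proof.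
have h : \sum_(r < b) `|hoff (cone_dir i) r| <= ((i != 0%N) && (i != 1%N))%:R.
  have E r : `|hoff (cone_dir i) r| = (i == r.+2)%:R / 2 :> R.
    by rewrite hoff_of mxE ger0_norm // divr_ge0.
  rewrite (eq_bigr _ (fun r _ => E r)).
  case: i {E} => [|[|i]]; first by rewrite big1 // => r _; rewrite mul0r.
    by rewrite big1 // => r _; rewrite mul0r.
  rewrite /= -mulr_suml.
  have [hi|hi] := ltnP i b.
    rewrite (bigD1 (Ordinal hi)) //= eqxx big1 => [|r hr].
      by rewrite addr0 mul1r invf_le1 // ler1n.
    by rewrite !eqSS eq_sym; move: hr; rewrite -val_eqE /= => /negbTE ->.
  rewrite big1 ?mul0r // => r _; rewrite !eqSS gtn_eqF //.
  exact: leq_trans (ltn_ord r) hi.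
split; apply: le_trans h _; rewrite ?hdiag0_of ?hdiag1_of ler_nat;
  by case: i => [|[]].
Qed.

Lemma hinner_cone_dir0 x : hinner (cone_dir 0) x = hdiag0 x.
Proof.
rewrite hinnerE hdiag0_of hdiag1_of big1 => [|r _]; first by rewrite /=; ring.
by rewrite hoff_of mxE mul0r mul0r.
Qed.

Lemma hinner_cone_dir1 x : hinner (cone_dir 1) x = hdiag1 x.
Proof.
rewrite hinnerE hdiag0_of hdiag1_of big1 => [|r _]; first by rewrite /=; ring.
by rewrite hoff_of mxE mul0r mul0r.
Qed.

Lemma hinner_cone_dirS x (r : 'I_b) :
  hinner (cone_dir r.+2) x = hdiag0 x + hdiag1 x + hoff x r.
Proof.
rewrite hinnerE hdiag0_of hdiag1_of /= (bigD1 r) //= big1 => [|s sr].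
  by rewrite hoff_of mxE eqxx /=; field.
by rewrite hoff_of mxE !eqSS [_ == _](negbTE _) ?mul0r // eq_sym.
Qed.

Lemma hcoord_real (r : 'I_b) (a : R) :
  hcoord (hreal b a) 0 r = (val r == 0)%:R * a.
Proof.
move: r; case: b => /= -[k hk]; rewrite !mxE //=.
- by case: k hk => // hk; rewrite mul1r.
- by case: k hk => [|[|//]] hk /=; rewrite ?mul1r ?mul0r.
- by case: k hk => [|[|[|[|//]]]] hk /=; rewrite ?mul1r ?mul0r.
Qed.

Lemma hcoord_conj (r : 'I_b) (z : hring R b) :
  hcoord (hconj z) 0 r = (-1) ^+ (val r != 0) * hcoord z 0 r.
Proof.
move: r z; case: b => /= -[k hk] z; rewrite !mxE //=.
- by case: k hk => // hk; rewrite mul1r.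
- by case: k hk => [|[|//]] hk /=; case: z => * /=; rewrite ?expr1 ?mul1r ?mulN1r.
- by case: k hk => [|[|[|[|//]]]] hk /=; rewrite ?mul1r ?mulN1r.
Qed.

(** The half compensates for the two off-diagonal entries in the inner product, so that pairing with
    x reads off a combination with coefficients exactly a, c and t. *)
Definition hdir (a c t : R) (r : 'I_b) : herm R b :=
  herm_of a c (\row_(s < b) ((s == r)%:R * t / 2)).

Lemma hinner_hdir a c t r x :
  hinner (hdir a c t r) x = a * hdiag0 x + c * hdiag1 x + t * hoff x r.
Proof.
rewrite hinnerE hdiag0_of hdiag1_of (bigD1 r) //= big1 => [|s sr].
  by rewrite hoff_of mxE eqxx /=; field.
by rewrite hoff_of mxE (negbTE sr) !mul0r.
Qed.

Lemma htr_hdir a c t r : htr (hdir a c t r) = a + c.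
Proof. by rewrite htrE hdiag0_of hdiag1_of. Qed.

Lemma gamma_form_hdir a c t r :
  gamma_form (hdir a c t r) = b%:R * (a + c) ^+ 2 + 4 * (a * c) - t ^+ 2.
Proof.
rewrite /gamma_form htr_hdir hdetE hdiag0_of hdiag1_of (bigD1 r) //= big1 => [|s sr].
  by rewrite hoff_of mxE eqxx /=; field.
by rewrite hoff_of mxE (negbTE sr) !mul0r expr0n.
Qed.

(** The trace of v is recorded because the mean of <v, X> is proportional to it; its value is the
    corresponding coordinate of the identity matrix. *)
Lemma hcoord_herm_hinner (i j : 'I_2) (r : 'I_b) :
  exists v, (forall x, hcoord (x i j) 0 r = hinner v x) /\
    htr v = ((i == j) && (val r == 0))%:R.
Proof.
case: (ord2P i) (ord2P j) => -> [] ->.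
- exists (hdir (val r == 0)%:R 0 0 r); split=> [x|]; last by rewrite htr_hdir addr0.
  by rewrite hinner_hdir herm_diag hcoord_real !mul0r !addr0.
- exists (hdir 0 0 1 r); split=> [x|]; last by rewrite htr_hdir addr0.
  by rewrite hinner_hdir /hoff; ring.
- exists (hdir 0 0 ((-1) ^+ (val r != 0)) r); split=> [x|]; last by rewrite htr_hdir addr0.
  by rewrite herm_adj hcoord_conj hinner_hdir /hoff; ring.
- exists (hdir 0 (val r == 0)%:R 0 r); split=> [x|]; last by rewrite htr_hdir add0r.
  by rewrite hinner_hdir herm_diag hcoord_real; rewrite -/(hdiag1 x); ring.
Qed.

Section Functions.
Context {d : measure_display} {T : measurableType d}.

(** The cone directions span the space. This form serves the sigma-algebra generated by orthants,
    about which only these directions are known at first. *)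
Lemma measurable_hinner_cone_dir (V : T -> herm R b) :
  (forall i, (i < b.+2)%N ->
    measurable_fun setT (fun w => hinner (cone_dir i) (V w))) ->
  forall v, measurable_fun setT (fun w => hinner v (V w)).
Proof.
move=> h v.
have m0 : measurable_fun setT (fun w => hdiag0 (V w)).
  by have := h 0 isT; under eq_fun do rewrite hinner_cone_dir0.
have m1 : measurable_fun setT (fun w => hdiag1 (V w)).
  by have := h 1 isT; under eq_fun do rewrite hinner_cone_dir1.
have mr r : measurable_fun setT (fun w => hoff (V w) r).
  rewrite (_ : (fun _ => _) = fun w =>
      hinner (cone_dir r.+2) (V w) - (hdiag0 (V w) + hdiag1 (V w))).
    apply: measurable_funB; last exact: measurable_funD.
    by apply: h; rewrite !ltnS.
  by apply/funext => w; rewrite hinner_cone_dirS; ring.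
under eq_fun do rewrite hinnerE.
apply: measurable_funD; first by apply: measurable_funD; exact: measurable_funM.
apply: measurable_funM => //; apply: measurable_sum => r.
by apply: measurable_funM.
Qed.

Lemma measurable_herm (V : T -> herm R b) :
  (forall v, measurable_fun setT (fun w => hinner v (V w))) ->
  measurable_fun setT V.
Proof.
move=> h; apply: (measurability (@herm_coord_sets R b)) => //.
move=> _ [_ [[[i j] r] _ [B mB <-]] <-]; rewrite /= !setTI.
have [v [hv _]] := hcoord_herm_hinner i j r.
have := h v measurableT _ mB; rewrite setTI; congr measurable.
by apply/seteqP; split => w /=; rewrite hv.
Qed.

End Functions.

Lemma measurable_hcoord_herm (i j : 'I_2) (r : 'I_b) :
  measurable_fun setT (fun x : herm R b => hcoord (x i j) 0 r).
Proof.
move=> _ B mB; rewrite setTI; apply: sub_sigma_algebra.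
by exists (i, j, r) => //; exists B => //; rewrite setTI.
Qed.

Lemma measurable_hinner v : measurable_fun setT (hinner v).
Proof.
have hre i : measurable_fun setT (fun x : herm R b => hRe (x i i)).
  have [r hr] : exists r : 'I_b, forall z : hring R b, hRe z = hcoord z 0 r.
    by clear; case: b => /=; exists ord0 => z; rewrite mxE.
  by under eq_fun do rewrite hr; exact: measurable_hcoord_herm.
rewrite (_ : hinner v = fun x => hdiag0 v * hdiag0 x + hdiag1 v * hdiag1 x +
  2 * \sum_(r < b) hoff v r * hoff x r); last by apply/funext => x; rewrite hinnerE.
apply: measurable_funD.
  by apply: measurable_funD; apply: measurable_funM => //; exact: hre.
apply: measurable_funM => //; apply: measurable_sum => r.
by apply: measurable_funM => //; exact: measurable_hcoord_herm.
Qed.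

End MeasurableHermitian.

(** * Uniqueness of Laplace transforms *)

Section LaplaceUniqueness.
Context {R : realType} {b : dyson}.
Implicit Types (x v : herm R b) (beta : nat -> R).

(** In the variables u_i = exp(- <v_i, x>) this is the box u_i <= exp(- beta_i), the kind of set
    that [same_mean_box] reaches; such sets form a pi-system. *)
Definition orthant beta : set (herm R b) :=
  [set x | forall i, (i < b.+2)%N -> beta i <= hinner (cone_dir i) x].

Definition orthants : set (set (herm R b)) := range orthant.

Lemma orthants_setI_closed : setI_closed orthants.
Proof.
move=> _ _ [beta _ <-] [gamma _ <-].
exists (fun i => Num.max (beta i) (gamma i)) => //; apply/seteqP; split => x.
  by move=> h; split=> i hi; have := h i hi; rewrite ge_max => /andP[].
by move=> [h1 h2] i hi; rewrite ge_max h1 ?h2.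
Qed.

Lemma measurable_orthants : @measurable _ (herm R b) = <<s orthants >>.
Proof.
apply/seteqP; split; last first.
  apply: smallest_sub; first exact: sigma_algebra_measurable.
  move=> _ [beta _ <-].
  rewrite (_ : orthant beta =
    \bigcap_(i in `I_(b.+2)) [set x | beta i <= hinner (cone_dir i) x]) //.
  apply: fin_bigcap_measurable => // i _.
  have mh : measurable_fun setT (@hinner R b (cone_dir i)) by exact: measurable_hinner.
  have := mh measurableT _ (measurable_itv `[beta i, +oo[).
  by rewrite setTI; congr measurable; apply/seteqP; split => x /=; rewrite in_itv /= andbT.
pose G := g_sigma_algebraType orthants.
suff mid : measurable_fun setT (idfun : G -> herm R b).
  by move=> A mA; rewrite -[A](setTI (A : set G)); exact: (mid measurableT A mA).
apply: measurable_herm; apply: measurable_hinner_cone_dir => i ik.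
apply: (measurability (@RGenCInfty.G R)); first exact: RGenCInfty.measurableE.
move=> _ [_ [s ->] <-]; rewrite setTI.
(* A half-space in one cone direction is the union of the orthants whose other bounds tend to minus
   infinity. *)
rewrite (_ : _ @^-1` _ = \bigcup_n orthant (fun j => if j == i then s else - n%:R)).
  apply: bigcupT_measurable => n; apply: sub_sigma_algebra; by eexists.
apply/seteqP; split => x /=; rewrite in_itv /= andbT.
  move=> sx; pose m := \sum_(j < b.+2) `|hinner (cone_dir j) x|.
  exists (Num.truncn m).+1 => // j jk; case: eqP => [->//|_].
  rewrite lerNl; apply: (@le_trans _ _ m); last exact/ltW/truncnS_gt.
  rewrite /m (bigD1 (Ordinal jk)) //= -[leLHS]addr0 lerD ?sumr_ge0 //.
  by rewrite -normrN ler_norm.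
by move=> [n _ /(_ i ik)]; rewrite eqxx.
Qed.

Context {d : measure_display} {T : measurableType d}.
Variable P : probability T R.

Lemma integral_preimage_indicator (h : T -> R) (D : set T) (u : T -> bool) :
  (forall w, u w <-> D w) ->
  (\int[P]_(w in D) (h w)%:E = \int[P]_w (h w * (u w)%:R)%:E)%E.
Proof.
move=> uD; rewrite integral_mkcond; apply: eq_integral => w _.
rewrite patchE; have [/set_mem/uD ->|/negP hw] := boolP (w \in D).
  by rewrite mulr1.
have /negbTE -> : ~~ u w by apply/negP => /uD /mem_set.
by rewrite mulr0.
Qed.

Lemma prod_bool (n : nat) (u : nat -> bool) :
  \prod_(i < n) (u i)%:R = [forall i : 'I_n, u i]%:R :> R.
Proof.
have [/forallP h|/forallPn[i hi]] := boolP [forall i : 'I_n, u i].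
  by rewrite big1 // => i _; rewrite h.
by rewrite (bigD1 i) //= (negbTE hi) mul0r.
Qed.

(** Two densities and two maps are allowed so that one statement covers both uses: the regression
    identity takes the same map S with two densities, rotation invariance takes density 1 with two
    maps. *)
Lemma laplace_unique (h1 h2 : T -> R) (V1 V2 : T -> herm R b) :
  measurable_fun setT V1 -> measurable_fun setT V2 ->
  P.-integrable setT (EFin \o h1) -> P.-integrable setT (EFin \o h2) ->
  (forall i, {ae P, forall w, 0 <= hinner (cone_dir i) (V1 w)}) ->
  (forall i, {ae P, forall w, 0 <= hinner (cone_dir i) (V2 w)}) ->
  (forall x, diag_dominant x ->
     same_mean P (fun w => h1 w * expR (hinner (- x) (V1 w)))
                 (fun w => h2 w * expR (hinner (- x) (V2 w)))) ->
  forall A, measurable A ->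
  (\int[P]_(w in V1 @^-1` A) (h1 w)%:E = \int[P]_(w in V2 @^-1` A) (h2 w)%:E)%E.
Proof.
move=> mV1 mV2 i1 i2 p1 p2 hL.
pose k := b.+2.
(* The support condition holds only almost surely, whereas [same_mean_box] wants it pointwise where
   the density is nonzero. Multiplying the density by this indicator changes no integral and bridges
   the gap. *)
pose ind (V : T -> herm R b) w : R :=
  \prod_(i < k) (0 <= hinner (cone_dir i) (V w))%R%:R.
have mind V : measurable_fun setT V -> measurable_fun setT (ind V).
  move=> mV; apply: measurable_prod => i _.
  rewrite (_ : (fun _ => _) = fun w => (- hinner (cone_dir i) (V w) <= 0)%R%:R).
    apply: measurable_le_indicator; apply: measurableT_comp => //.
    exact: measurableT_comp (measurable_hinner _) mV.
  by apply/funext => w; rewrite oppr_le0.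
have ind1 V : (forall i, {ae P, forall w, 0 <= hinner (cone_dir i) (V w)}) ->
    {ae P, forall w, ind V w = 1}.
  move=> /ae_foralln; apply: filterS => w h; rewrite /ind big1 // => i _.
  by rewrite h.
have trunc (h : T -> R) V : measurable_fun setT V ->
    P.-integrable setT (EFin \o h) ->
    (forall i, {ae P, forall w, 0 <= hinner (cone_dir i) (V w)}) ->
    P.-integrable setT (EFin \o (fun w => h w * ind V w)) /\
    forall A, measurable A ->
    (\int[P]_(w in V @^-1` A) (h w)%:E = \int[P]_(w in V @^-1` A) (h w * ind V w)%:E)%E.
  move=> mV hi pV.
  have mg : measurable_fun setT (fun w => h w * ind V w).
    apply: measurable_funM; last exact: mind.
    by have /measurable_int/measurable_EFinP := hi.
  have ae_hg : {ae P, forall w, h w = h w * ind V w}.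
    by apply: filterS (ind1 V pV) => w ->; rewrite mulr1.
  have mp A : measurable A -> measurable (V @^-1` A).
    by move=> mA; rewrite -[X in measurable X]setTI; exact: mV.
  split; first by case: (integrable_integral_ae measurableT mg ae_hg hi).
  by move=> A mA; case: (integrable_integral_ae (mp A mA) mg ae_hg hi).
have [g1i E1] := trunc _ _ mV1 i1 p1.
have [g2i E2] := trunc _ _ mV2 i2 p2.
suff main : forall A, measurable A ->
    (\int[P]_(w in V1 @^-1` A) (h1 w * ind V1 w)%:E =
     \int[P]_(w in V2 @^-1` A) (h2 w * ind V2 w)%:E)%E.
  by move=> A mA; rewrite E1 // E2 // main.
set g1 := fun w => h1 w * ind V1 w in g1i *.
set g2 := fun w => h2 w * ind V2 w in g2i *.
pose u (V : T -> herm R b) i w := expR (hinner (- cone_dir i) (V w)).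
have mu V i : measurable_fun setT V -> measurable_fun setT (u V i).
  move=> mV; apply: measurableT_comp => //.
  exact: measurableT_comp (measurable_hinner _) mV.
have supp (h : T -> R) V i : (i < k)%N ->
    forall w, h w * ind V w != 0 -> 0 <= u V i w <= 1.
  move=> ik w; rewrite mulf_eq0 negb_or => /andP[_].
  rewrite expR_ge0 /= -expR0 ler_expR hinnerNl oppr_le0.
  rewrite /ind (bigD1 (Ordinal ik)) //= mulf_eq0 negb_or => /andP[+ _].
  by case: (0 <= _)%R => //; rewrite eqxx.
have moments (n : nat -> nat) :
    same_mean P (fun w => g1 w * \prod_(i < k) u V1 i w ^+ n i)
                (fun w => g2 w * \prod_(i < k) u V2 i w ^+ n i).
  (* A monomial in the u_i is the exponential of minus the inner product with this integer
     combination of cone directions, so all moments are values of the Laplace transform on the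
     cone. *)
  pose x := \sum_(i < k) cone_dir i *+ n i : herm R b.
  have hx : diag_dominant x.
    apply: big_ind => [||i _]; [exact: diag_dominant0|exact: diag_dominantD|].
    exact/diag_dominantMn/cone_dir_dominant.
  have prodE V w : \prod_(i < k) u V i w ^+ n i = expR (hinner (- x) (V w)).
    have lin (s : seq 'I_k) : \prod_(i <- s) u V i w ^+ n i =
        expR (hinner (- \sum_(i <- s) cone_dir i *+ n i) (V w)).
      elim: s => [|i s IH]; first by rewrite !big_nil oppr0 hinner0l expR0.
      rewrite !big_cons IH opprD hinnerDl expRD; congr (_ * _).
      by rewrite /u -expRM_natl; congr expR; rewrite -[cone_dir i *+ n i]scaler_nat !hinnerNl hinnerZl mulrN.
    exact: lin.
  have [l [m1 m2]] := hL x hx.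
  exists l; split.
  - apply: has_mean_ae m1; last first.
      by apply: filterS (ind1 V1 p1) => w e; rewrite /g1 e mulr1 prodE.
    apply: measurable_funM; first by have /measurable_int/measurable_EFinP := g1i.
    by apply: measurable_prod => i _; apply: measurable_funX; exact: mu.
  - apply: has_mean_ae m2; last first.
      by apply: filterS (ind1 V2 p2) => w e; rewrite /g2 e mulr1 prodE.
    apply: measurable_funM; first by have /measurable_int/measurable_EFinP := g2i.
    by apply: measurable_prod => i _; apply: measurable_funX; exact: mu.
(* The zeroth moment; in the Dynkin induction the complement case subtracts from this common
   total. *)
have total : (\int[P]_w (g1 w)%:E = \int[P]_w (g2 w)%:E)%E.
  have [l [[_ e1] [_ e2]]] := moments (fun=> 0%N).
  transitivity l%:E; [rewrite -e1|rewrite -e2]; apply: eq_integral => w _;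
    by rewrite big1 ?mulr1 // => i _; rewrite expr0.
have mp (V : T -> herm R b) A : measurable_fun setT V -> measurable A ->
    measurable (V @^-1` A).
  by move=> mV mA; rewrite -[X in measurable X]setTI; exact: mV.
rewrite measurable_orthants.
apply: (dynkin_induction measurable_orthants orthants_setI_closed).
- by rewrite !preimage_setT.
- move=> _ [beta _ <-].
  have [l [[_ e1] [_ e2]]] := @same_mean_box _ _ _ P k g1 g2 (u V1) (u V2)
    (fun i => expR (- beta i)) (fun i => expR_gt0 _) (fun i => mu V1 i mV1)
    (fun i => mu V2 i mV2) (fun i ik => supp h1 V1 i ik) (fun i ik => supp h2 V2 i ik) moments.
  have iff V w : [forall i : 'I_k, u V i w <= expR (- beta i)] <->
      (V @^-1` orthant beta) w.
    split=> [/forallP h i ik|h].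
      by have := h (Ordinal ik); rewrite ler_expR hinnerNl lerN2.
    by apply/forallP => i; rewrite ler_expR hinnerNl lerN2; exact: h.
  rewrite (integral_preimage_indicator g1 (iff V1)).
  rewrite (integral_preimage_indicator g2 (iff V2)).
  transitivity l%:E; [rewrite -e1|rewrite -e2]; apply: eq_integral => w _;
    by rewrite (prod_bool k (fun i => u _ i w <= expR (- beta i))).
- move=> A mA EA.
  have split_int (g : T -> R) V : measurable_fun setT V ->
      P.-integrable setT (EFin \o g) ->
      (\int[P]_(w in V @^-1` ~` A) (g w)%:E =
       \int[P]_w (g w)%:E - \int[P]_(w in V @^-1` A) (g w)%:E)%E.
    move=> mV gi; have gA : P.-integrable (V @^-1` A) (EFin \o g).
      by apply: integrableS gi => //; exact: mp.
    have -> : (\int[P]_w (g w)%:E =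
        \int[P]_(w in V @^-1` A `|` ~` (V @^-1` A)) (g w)%:E)%E by rewrite setUv.
    rewrite integral_setU_EFin //.
    + rewrite addeAC subee ?add0e //.
      exact: (integrable_fin_num (mp _ _ mV mA) gA).
    + exact: mp.
    + by apply: measurableC; exact: mp.
    + by rewrite setUv; have /measurable_int/measurable_EFinP := gi.
    + by rewrite disj_set2E setICr.
  by rewrite (split_int g1) // (split_int g2) // total EA.
- move=> F mF tF EF.
  have series (g : T -> R) V : measurable_fun setT V ->
      P.-integrable setT (EFin \o g) ->
      (\int[P]_(w in V @^-1` (\bigcup_n F n)) (g w)%:E =
       \sum_(n <oo) \int[P]_(w in V @^-1` F n) (g w)%:E)%E.
    move=> mV gi; rewrite preimage_bigcup integral_bigcup //.
    + apply/trivIsetP => i j _ _ ij; have /trivIsetP/(_ i j I I ij) e := tF.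
      by apply/seteqP; split => // w [/= Fi Fj]; have : (F i `&` F j) (V w) by []; rewrite e.
    + by move=> i; exact: mp.
    + apply: integrableS gi => //; apply: bigcupT_measurable => i; exact: mp.
  rewrite (series g1) // (series g2) //; apply: eq_eseriesr => n _; exact: EF.
Qed.

End LaplaceUniqueness.

(** * The gamma law *)

Section Rotations.
Context {R : realType} {b : dyson}.
Implicit Types (x y v : herm R b) (A B U : 'M[hring R b]_2).

Lemma hRe0 : hRe (0 : hring R b) = 0.
Proof. by case: b. Qed.

Lemma hRe_mulC (z w : hring R b) : hRe (z * w) = hRe (w * z).
Proof. by move: z w; case: b => /= [z w|[? ?] [? ?]|[? ? ? ?] [? ? ? ?]] /=; ring. Qed.

Lemma hRe_sum (I : Type) (s : seq I) (F : I -> hring R b) :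
  hRe (\sum_(i <- s) F i) = \sum_(i <- s) hRe (F i).
Proof. by apply: (big_morph _ hReD hRe0). Qed.

(** Over the quaternions the trace itself is not cyclic, but its real part is, because Re(zw) =
    Re(wz). *)
Lemma hRe_mxtraceC A B : hRe (\tr (A *m B)) = hRe (\tr (B *m A)).
Proof.
rewrite !hRe_sum; under eq_bigr do rewrite mxE hRe_sum.
rewrite exchange_big /=; apply: eq_bigr => j _.
by rewrite mxE hRe_sum; apply: eq_bigr => i _; rewrite hRe_mulC.
Qed.

Lemma hinner_conj x y U : hinner x (herm_conj U y) = hinner (herm_conj (adjmx U) x) y.
Proof.
rewrite /hinner /= adjmxK !mulmxA hRe_mxtraceC !mulmxA.
by congr (hRe (\tr (_ *m _))); rewrite !mulmxA.
Qed.

Lemma herm_conjK x U : unitary U -> herm_conj (adjmx U) (herm_conj U x) = x.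
Proof.
move=> [_ h]; apply: val_inj => /=.
by rewrite adjmxK !mulmxA h mul1mx -mulmxA h mulmx1.
Qed.

Lemma unitary_adj U : unitary U -> unitary (adjmx U).
Proof. by move=> [h1 h2]; split; rewrite adjmxK. Qed.

Lemma htr_conj x U : unitary U -> htr (herm_conj U x) = htr x.
Proof. by move=> [_ h]; rewrite /htr /= hRe_mxtraceC mulmxA h mul1mx. Qed.

(** For Hermitian 2 x 2 matrices, 2 det x = (tr x)^2 - <x, x>. This removes the determinant in
    favour of quantities whose invariance under conjugation follows from cyclicity. *)
Lemma gamma_form_inner x :
  gamma_form x = b%:R * htr x ^+ 2 + 2 * (htr x ^+ 2 - hinner x x).
Proof.
rewrite /gamma_form hdetE hinnerE htrE.
under [in RHS]eq_bigr do rewrite -expr2.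
by ring.
Qed.

Lemma gamma_form_conj x U : unitary U -> gamma_form (herm_conj U x) = gamma_form x.
Proof.
by move=> hU; rewrite !gamma_form_inner htr_conj // hinner_conj herm_conjK.
Qed.

Lemma gamma_expr_conj c x U : unitary U ->
  gamma_expr c (herm_conj U x) = gamma_expr c x.
Proof. by move=> hU; rewrite !gamma_exprE htr_conj // gamma_form_conj. Qed.

Lemma measurable_herm_conj U : measurable_fun setT (@herm_conj R b U).
Proof.
apply: measurable_herm => v; under eq_fun do rewrite hinner_conj.
exact: measurable_hinner.
Qed.

Lemma measurable_hermD {d} {T : measurableType d} (V W : T -> herm R b) :
  measurable_fun setT V -> measurable_fun setT W ->
  measurable_fun setT (fun w => V w + W w).
Proof.
move=> mV mW; apply: measurable_herm => v; under eq_fun do rewrite hinnerDr.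
by apply: measurable_funD; apply: measurableT_comp => //; exact: measurable_hinner.
Qed.

Lemma measurable_hermZ {d} {T : measurableType d} (V : T -> herm R b) (s : R) :
  measurable_fun setT V -> measurable_fun setT (fun w => s *: V w).
Proof.
move=> mV; apply: measurable_herm => v; under eq_fun do rewrite hinnerZr.
by apply: measurable_funM => //; apply: measurableT_comp => //; exact: measurable_hinner.
Qed.

End Rotations.

Section GammaLaw.
Context {R : realType} {b : dyson}.
Variables (p c : R) (mu : probability (herm R b) R).
Hypotheses (p0 : 0 < p) (c1 : 1 < c) (hmu : gamma_ensemble mu p c).
Implicit Types (x y v : herm R b) (t : R).

Definition gamma_laplace x := gamma_expr c x `^ (- p).

Lemma gamma_domain_mean x : gamma_domain c x ->
  has_mean mu (fun y => expR (hinner x y)) (gamma_laplace x).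
Proof.
move=> hx; have E := hmu hx; split=> //.
apply/integrableP; split.
  apply/measurable_EFinP; apply: measurableT_comp => //; exact: measurable_hinner.
rewrite (_ : (\int[mu]_w _ = (gamma_laplace x)%:E)%E) ?ltry // -[RHS]E.
by apply: eq_integral => w _ /=; rewrite ger0_norm // expR_ge0.
Qed.

Lemma gamma_domain_nonpos x : htr x <= 0 -> 0 <= gamma_form x ->
  gamma_domain c x /\ 1 <= gamma_expr c x.
Proof.
move=> h1 h2.
have h : 2 * c * Num.sqrt (1 + b%:R) * htr x <= 0.
  by rewrite mulr_ge0_le0 // !mulr_ge0 ?sqrtr_ge0 // ltW // (lt_trans _ c1).
split; last by rewrite gamma_exprE; lra.
by case: (@gamma_domain_sufficient _ _ c x) => //; lra.
Qed.

Lemma gamma_laplace_le1 x : htr x <= 0 -> 0 <= gamma_form x -> gamma_laplace x <= 1.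
Proof.
move=> h1 h2; have [_ h] := gamma_domain_nonpos h1 h2.
by rewrite -(powRr0 (gamma_expr c x)) ler_powR // oppr_le0 ltW.
Qed.

(** The two conditions define a cone, so the Laplace transform is at most 1 at every multiple n x
    and [ae_le0] applies. *)
Lemma gamma_hinner_le0 x : htr x <= 0 -> 0 <= gamma_form x ->
  {ae mu, forall y, hinner x y <= 0}.
Proof.
move=> h1 h2; apply: ae_le0; first exact: measurable_hinner.
move=> n; exists (gamma_laplace (n%:R *: x)).
have k1 : htr (n%:R *: x) <= 0 by rewrite htrZ mulr_ge0_le0.
have k2 : 0 <= gamma_form (n%:R *: x) by rewrite gamma_formZ mulr_ge0 // sqr_ge0.
split; first exact: gamma_laplace_le1.
apply: eq_has_mean (gamma_domain_mean (proj1 (gamma_domain_nonpos k1 k2))) => y.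
by rewrite hinnerZl.
Qed.

Lemma diag_dominant_opp x : diag_dominant x -> htr (- x) <= 0 /\ 0 <= gamma_form (- x).
Proof.
move=> /diag_dominant_ge0[h1 h2].
rewrite -scaleN1r htrZ gamma_formZ sqrrN expr1n mul1r; split => //.
by rewrite mulN1r oppr_le0.
Qed.

Lemma gamma_cone_ge0 i : {ae mu, forall y, 0 <= hinner (cone_dir i) y}.
Proof.
have [h1 h2] := diag_dominant_opp (cone_dir_dominant i).
by apply: filterS (gamma_hinner_le0 h1 h2) => y; rewrite hinnerNl oppr_le0.
Qed.

Lemma gamma_rotation_invariant : rotation_invariant mu.
Proof.
move=> U hU d T P X [mX lX]; split.
  by apply: measurableT_comp mX; exact: measurable_herm_conj.
move=> A mA.
have mUA : measurable (@herm_conj R b U @^-1` A).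
  by rewrite -[X in measurable X]setTI; exact: measurable_herm_conj.
have -> : (fun w => herm_conj U (X w)) @^-1` A = X @^-1` (herm_conj U @^-1` A) by [].
rewrite lX //.
have one : mu.-integrable setT (EFin \o (fun=> 1 : R)) by case: (has_mean_cst mu 1).
have hUa := unitary_adj hU.
have mid : measurable_fun setT (fun x : herm R b => x) by [].
have conjE x y : hinner x (herm_conj U y) = hinner (herm_conj (adjmx U) x) y.
  exact: hinner_conj.
(* Diagonal dominance is not preserved by rotations; the two sign conditions are, and they suffice
   for the support and for membership in the domain. *)
have inv x : htr (- x) <= 0 /\ 0 <= gamma_form (- x) ->
    htr (herm_conj (adjmx U) (- x)) <= 0 /\
    0 <= gamma_form (herm_conj (adjmx U) (- x)).
  by move=> [h1 h2]; rewrite htr_conj // gamma_form_conj.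
have := @laplace_unique _ _ _ _ mu (fun=> 1) (fun=> 1) (herm_conj U) (fun x => x)
  (@measurable_herm_conj _ _ U) mid one one.
move=> /(_ _ _ _ A mA).
have int1 (B : set (herm R b)) : measurable B -> (\int[mu]_(w in B) 1%:E = mu B)%E.
  by move=> mB; rewrite integral_cst // mul1e.
rewrite !int1 // preimage_id; apply.
- move=> i; have [h1 h2] := inv _ (diag_dominant_opp (cone_dir_dominant i)).
  by apply: filterS (gamma_hinner_le0 h1 h2) => y; rewrite -conjE hinnerNl oppr_le0.
- exact: gamma_cone_ge0.
- move=> x hx; exists (gamma_laplace (- x)).
  have [h1 h2] := inv _ (diag_dominant_opp hx).
  have [k1 k2] := diag_dominant_opp hx.
  split; last first.
    apply: eq_has_mean (gamma_domain_mean (proj1 (gamma_domain_nonpos k1 k2))) => y.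
    by rewrite mul1r.
  have := gamma_domain_mean (proj1 (gamma_domain_nonpos h1 h2)).
  rewrite /gamma_laplace gamma_expr_conj //; apply: eq_has_mean => y.
  by rewrite mul1r conjE.
Qed.

End GammaLaw.

(** * Entries of x^2 as combinations of squares of linear functionals *)

Section SquareEntries.
Context {R : realType} {b : dyson}.
Implicit Types (x : herm R b) (k : R * herm R b).

Lemma mul_hconj (z : hring R b) : z * hconj z = hreal b (hnormsq z).
Proof.
move: z; case: b => /= z; rewrite /hnormsq !big_ord_recl !big_ord0 !mxE /=.
- by ring.
- by case: z => a c; apply/eqP; rewrite eq_complex /=; apply/andP; split; apply/eqP; ring.
- by case: z => *; congr Quat => /=; ring.
Qed.

Lemma hconj_mul (z : hring R b) : hconj z * z = hreal b (hnormsq z).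
Proof.
move: z; case: b => /= z; rewrite /hnormsq !big_ord_recl !big_ord0 !mxE /=.
- by ring.
- by case: z => a c; apply/eqP; rewrite eq_complex /=; apply/andP; split; apply/eqP; ring.
- by case: z => *; congr Quat => /=; ring.
Qed.

Lemma herm_sqrE x :
  [/\ (herm_mx x ^+ 2) 0 0 = hreal b (hdiag0 x ^+ 2 + hnormsq (x 0 1)),
      (herm_mx x ^+ 2) 0 1 = hreal b (hdiag0 x + hdiag1 x) * x 0 1,
      (herm_mx x ^+ 2) 1 0 = hconj (hreal b (hdiag0 x + hdiag1 x) * x 0 1) &
      (herm_mx x ^+ 2) 1 1 = hreal b (hdiag1 x ^+ 2 + hnormsq (x 0 1))].
Proof.
have E i j : (herm_mx x ^+ 2) i j = x i 0 * x 0 j + x i 1 * x 1 j.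
  rewrite expr2 mxE !big_ord_recl big_ord0 addr0.
  by have -> : lift ord0 ord0 = 1 :> 'I_2 by apply/val_inj.
rewrite !E (herm_diag x 0) (herm_diag x 1) (herm_adj x 1 0) -/(hdiag0 x) -/(hdiag1 x).
rewrite mul_hconj hconj_mul -!hrealM !hrealD hconjM hconjD !hconj_real !expr2 mulrDl mulrDr.
split => //; first by rewrite (hrealC (hdiag1 x)).
  by rewrite (hrealC (hdiag1 x)).
by rewrite addrC.
Qed.

(* The vanishing of the second sum is the trace condition which makes the
   second derivatives of the quadratic drop out of the Laplace transform. *)
Lemma herm_sqr_entry (i j : 'I_2) (r : 'I_b) :
  exists s : seq (R * herm R b),
  [/\ forall x, hcoord ((herm_mx x ^+ 2) i j) 0 r =
        \sum_(k <- s) k.1 * hinner k.2 x ^+ 2,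
      \sum_(k <- s) k.1 * gamma_form k.2 = 0 &
      \sum_(k <- s) k.1 * htr k.2 ^+ 2 = ((i == j) && (val r == 0))%:R].
Proof.
(* Here a is 1 or 0 and selects the diagonal entry, which makes a(1 - a) vanish; u is false for
   imaginary coordinates, where the diagonal of x^2 is zero. *)
have diag (a : R) (u : bool) :
    \sum_(k <- (u%:R, hdir a (1 - a) 0 r) ::
       [seq (u%:R, hdir 0 0 1 r') | r' <- index_enum 'I_b])
       k.1 * gamma_form k.2 = u%:R * (4 * (a * (1 - a))) /\
    \sum_(k <- (u%:R, hdir a (1 - a) 0 r) ::
       [seq (u%:R, hdir 0 0 1 r') | r' <- index_enum 'I_b])
       k.1 * htr k.2 ^+ 2 = u%:R :> R.
  rewrite !big_cons !big_map /=; split.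
    under eq_bigr do rewrite gamma_form_hdir.
    by rewrite sumr_const card_ord gamma_form_hdir -mulr_natr; ring.
  under eq_bigr do rewrite htr_hdir.
  by rewrite sumr_const card_ord htr_hdir -mulr_natr; ring.
have diagE (a : R) (u : bool) x :
    \sum_(k <- (u%:R, hdir a (1 - a) 0 r) ::
       [seq (u%:R, hdir 0 0 1 r') | r' <- index_enum 'I_b])
       k.1 * hinner k.2 x ^+ 2 =
    u%:R * ((a * hdiag0 x + (1 - a) * hdiag1 x) ^+ 2 + hnormsq (x 0 1)).
  rewrite big_cons big_map /= mulrDr hinner_hdir mul0r addr0; congr (_ + _).
  rewrite /hnormsq mulr_sumr; apply: eq_bigr => q _.
  by rewrite hinner_hdir !mul0r !add0r mul1r.
(* Polarization: with T the trace and o an off-diagonal coordinate, T o = ((T + o)^2 - (T - o)^2) /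
   4, and the two directions have the same trace and the same quadratic part. *)
have off (u : R) :
    let s := [:: (u / 4, hdir 1 1 1 r); (- u / 4, hdir 1 1 (-1) r)] in
  [/\ forall x, \sum_(k <- s) k.1 * hinner k.2 x ^+ 2 =
        u * ((hdiag0 x + hdiag1 x) * hoff x r),
      \sum_(k <- s) k.1 * gamma_form k.2 = 0 &
      \sum_(k <- s) k.1 * htr k.2 ^+ 2 = 0].
  by split=> [x||]; rewrite !big_cons big_nil /= ?hinner_hdir ?gamma_form_hdir ?htr_hdir; field.
case: (ord2P i) (ord2P j) => -> [] ->.
- have [h1 h2] := diag 1 (val r == 0); eexists; split; last exact: h2.
    move=> x; have [-> _ _ _] := herm_sqrE x; rewrite diagE hcoord_real; ring.
  by rewrite h1; ring.
- have [h0 h1 h2] := off 1; eexists; split; last exact: h2; last exact: h1.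
  by move=> x; have [_ -> _ _] := herm_sqrE x; rewrite h0 hcoordZ mxE mul1r.
- have [h0 h1 h2] := off ((-1) ^+ (val r != 0)); eexists; split; last exact: h2; last exact: h1.
  by move=> x; have [_ _ -> _] := herm_sqrE x; rewrite h0 hcoord_conj hcoordZ mxE.
- have [h1 h2] := diag 0 (val r == 0); eexists; split; last exact: h2.
    move=> x; have [_ _ _ ->] := herm_sqrE x; rewrite diagE hcoord_real; ring.
  by rewrite h1; ring.
Qed.

End SquareEntries.

(** * Moments of the gamma law, weighted by exponentials *)

Section GammaMoments.
Context {R : realType} {b : dyson}.
Variables (p c : R) (mu : probability (herm R b) R).
Hypotheses (p0 : 0 < p) (c1 : 1 < c) (hmu : gamma_ensemble mu p c).
Implicit Types (x y v : herm R b) (t : R).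

Let q x v t := quad (gamma_expr c (- x)) (gamma_slope c (- x) v) (gamma_form v) t.

Lemma gamma_line_mean x v : diag_dominant x ->
  exists2 e : R, 0 < e & forall t, `|t| <= e -> 0 < q x v t /\
    has_mean mu (fun y => expR (hinner (- x) y + t * hinner v y)) (q x v t `^ (- p)).
Proof.
move=> hx; have [e e0 he] := gamma_domain_near v c1 hx.
exists e => // t /he[h1 h2]; rewrite /q -gamma_expr_line; split => //.
apply: eq_has_mean (gamma_domain_mean hmu h1) => y.
by rewrite hinnerDl hinnerZl.
Qed.

Lemma gamma_expr_opp_gt0 x : diag_dominant x -> 0 < gamma_expr c (- x).
Proof.
move=> /diag_dominant_opp[h1 h2].
by have [_] := gamma_domain_nonpos c1 h1 h2; exact: lt_le_trans.
Qed.

Context {d : measure_display} {T : measurableType d} (P : probability T R).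
Variables X Y : T -> herm R b.
Hypothesis (lX : has_law P X mu).

Let mhX v : measurable_fun setT (fun w => hinner v (X w)).
Proof. by case: lX => mX _; exact: measurableT_comp (measurable_hinner _) mX. Qed.

(** At the origin Q has value 1 and slope -2c sqrt(1+beta) tr v. The term with [gamma_form v] in the
    second moment disappears only in the combinations supplied by [herm_sqr_entry]. *)
Lemma gamma_law_mean v :
  has_mean P (fun w => hinner v (X w))
    (2 * p * c * Num.sqrt (1 + b%:R) * htr v) /\
  has_mean P (fun w => hinner v (X w) ^+ 2)
    (4 * p * (p + 1) * c ^+ 2 * (1 + b%:R) * htr v ^+ 2 - 2 * p * gamma_form v).
Proof.
have [e e0 he] := gamma_line_mean v (diag_dominant0 (R := R) (b := b)).
have E w : expR (hinner (- 0) (X w)) = 1 by rewrite oppr0 hinner0l expR0.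
have a1 : gamma_expr c (- 0 : herm R b) = 1 by rewrite oppr0 gamma_expr0.
have hg t : `|t| <= e ->
    has_mean P (fun w => expR (hinner (- 0) (X w) + t * hinner v (X w)))
      (quad 1 (gamma_slope c (- 0) v) (gamma_form v) t `^ (- p)).
  by move=> /he[_]; rewrite /q a1 => h; apply: (has_law_mean lX _ h) => y; exact: expR_ge0.
have sE : gamma_slope c (- 0) v = - (2 * c * Num.sqrt (1 + b%:R) * htr v).
  by rewrite oppr0 /gamma_slope gamma_polar0 sub0r.
have s2 : Num.sqrt (1 + b%:R) ^+ 2 = 1 + b%:R :> R by rewrite sqr_sqrtr // addr_ge0.
split.
  have D := is_derive_cvg_symmetric (is_derive_quad_powR (gamma_slope c (- 0) v)
    (gamma_form v) (- p) (ltr01 : 0 < (1 : R))).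
  have := has_mean_derive e0 (mhX _) (mhX v) hg D.
  rewrite powR1 sE [X in has_mean _ _ X](_ : _ = 2 * p * c * Num.sqrt (1 + b%:R) * htr v).
    by apply: eq_has_mean => w; rewrite E mulr1.
  by ring.
have D := @cvg_quad_second R 1 (gamma_slope c (- 0) v) (gamma_form v) p ltr01.
have := has_mean_derive2 e0 (mhX _) (mhX v) hg D.
rewrite powR1 sE [X in has_mean _ _ X](_ : _ =
  4 * p * (p + 1) * c ^+ 2 * (1 + b%:R) * htr v ^+ 2 - 2 * p * gamma_form v).
  by apply: eq_has_mean => w; rewrite E mulr1.
by set k := Num.sqrt _ in s2 *; rewrite -s2; ring.
Qed.

Hypotheses (lY : has_law P Y mu) (ind : independent P X Y).

Let mhY v : measurable_fun setT (fun w => hinner v (Y w)).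
Proof. by case: lY => mY _; exact: measurableT_comp (measurable_hinner _) mY. Qed.

Let mhS v : measurable_fun setT (fun w => hinner v (X w + Y w)).
Proof. by under eq_fun do rewrite hinnerDr; exact: measurable_funD. Qed.

Let mhD v : measurable_fun setT (fun w => hinner v (X w - Y w)).
Proof.
by under eq_fun do rewrite hinnerDr hinnerNr; exact: measurable_funB.
Qed.

Lemma gamma_difference_mean x v : diag_dominant x ->
  has_mean P (fun w => hinner v (X w - Y w) ^+ 2 * expR (hinner (- x) (X w + Y w)))
    (2 * (- p * (2 * gamma_expr c (- x) * gamma_form v - gamma_slope c (- x) v ^+ 2) *
      gamma_expr c (- x) `^ (- (2 * p) - 2))).
Proof.
move=> hx; have a0 := gamma_expr_opp_gt0 hx.
have [e e0 he] := gamma_line_mean v hx.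
have D := @cvg_quad_product_second R _ (gamma_slope c (- x) v) (gamma_form v) p a0.
apply: (has_mean_derive2 e0 (mhS _) (mhD v) _ D) => t te.
have tNe : `|- t| <= e by rewrite normrN.
have [q1 m1] := he t te; have [q2 m2] := he _ tNe.
rewrite -/(q x v t) -/(q x v (- t)) powRM ?ltW //.
apply: eq_has_mean (independent_mean lX lY ind _ _ m1 m2) => [w|y|y]; rewrite ?expR_ge0 //.
by rewrite -expRD !hinnerDr hinnerNr; congr expR; ring.
Qed.

(** By independence S has Laplace transform Q^(-2p), so this is the one-variable computation with 2p
    in place of p. *)
Lemma gamma_sum_mean x v : diag_dominant x ->
  has_mean P (fun w => hinner v (X w + Y w) ^+ 2 * expR (hinner (- x) (X w + Y w)))
    ((2 * p * (2 * p + 1) * gamma_slope c (- x) v ^+ 2 -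
      2 * (2 * p) * gamma_expr c (- x) * gamma_form v) *
      gamma_expr c (- x) `^ (- (2 * p) - 2)).
Proof.
move=> hx; have a0 := gamma_expr_opp_gt0 hx.
have [e e0 he] := gamma_line_mean v hx.
have D := @cvg_quad_second R _ (gamma_slope c (- x) v) (gamma_form v) (2 * p) a0.
apply: (has_mean_derive2 e0 (mhS _) (mhS v) _ D) => t te.
have [q1 m1] := he t te.
have -> : - (2 * p) = - p + - p by ring.
rewrite -/(q x v t) powRD; last by rewrite (gt_eqF q1) implybT.
apply: eq_has_mean (independent_mean lX lY ind _ _ m1 m1) => [w|y|y]; rewrite ?expR_ge0 //.
by rewrite -expRD !hinnerDr; congr expR; ring.
Qed.

Lemma gamma_regression (i j : 'I_2) (r : 'I_b) :
  [/\ P.-integrable setT (EFin \o (fun w => hcoord ((herm_mx (X w - Y w) ^+ 2) i j) 0 r)),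
      P.-integrable setT (EFin \o (fun w => hcoord ((herm_mx (X w + Y w) ^+ 2) i j) 0 r)) &
      forall A, measurable A ->
      (\int[P]_(w in (fun w => X w + Y w)%R @^-1` A)
         (hcoord ((herm_mx (X w - Y w) ^+ 2) i j) 0 r)%R%:E =
       \int[P]_(w in (fun w => X w + Y w)%R @^-1` A)
         (1 / (1 + 2 * p) * hcoord ((herm_mx (X w + Y w) ^+ 2) i j) 0 r)%R%:E)%E].
Proof.
have [s [sE sf _]] := @herm_sqr_entry R b i j r.
have mean x : diag_dominant x -> exists l,
    has_mean P (fun w => hcoord ((herm_mx (X w - Y w) ^+ 2) i j) 0 r *
      expR (hinner (- x) (X w + Y w))) l /\
    has_mean P (fun w => 1 / (1 + 2 * p) * hcoord ((herm_mx (X w + Y w) ^+ 2) i j) 0 r *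
      expR (hinner (- x) (X w + Y w))) l.
  move=> hx.
  have mD := has_mean_sum s (fun k => has_meanZ k.1 (gamma_difference_mean k.2 hx)).
  have mS := has_meanZ (1 / (1 + 2 * p))
    (has_mean_sum s (fun k => has_meanZ k.1 (gamma_sum_mean k.2 hx))).
  set lD := \sum_(k <- s) _ in mD; set lS := _ * \sum_(k <- s) _ in mS.
  have lE : lD = lS.
    apply/eqP; rewrite -subr_eq0 /lS mulr_sumr /lD -sumrB; apply/eqP.
    (* After the squared slopes cancel, the factor 1 - 1/(1+2p) = 2p/(1+2p) remains on the quadratic
       part. K does not depend on the direction, so [sf] annihilates the sum. *)
    pose K := - (2 * p / (1 + 2 * p)) * 4 * p * gamma_expr c (- x) *
      gamma_expr c (- x) `^ (- (2 * p) - 2).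
    rewrite (eq_bigr (fun k => K * (k.1 * gamma_form k.2))).
      by rewrite -mulr_sumr sf mulr0.
    move=> k _; rewrite /K; have : 1 + 2 * p != 0 by rewrite gt_eqF // addr_gt0 // mulr_gt0.
    by move=> h; field.
  exists lD; split; last rewrite lE.
    by apply: eq_has_mean mD => w; rewrite sE mulr_suml; apply: eq_bigr => k _; rewrite mulrA.
  apply: eq_has_mean mS => w; rewrite sE -mulrA mulr_suml; congr (_ * _).
  by apply: eq_bigr => k _; rewrite mulrA.
have e0 w : expR (hinner (- 0) (X w + Y w)) = 1 by rewrite oppr0 hinner0l expR0.
have [l0 [h1 h2]] := mean _ (diag_dominant0 (R := R) (b := b)).
have {}h1 : has_mean P (fun w => hcoord ((herm_mx (X w - Y w) ^+ 2) i j) 0 r) l0.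
  by apply: eq_has_mean h1 => w; rewrite e0 mulr1.
have {}h2 : has_mean P
    (fun w => 1 / (1 + 2 * p) * hcoord ((herm_mx (X w + Y w) ^+ 2) i j) 0 r) l0.
  by apply: eq_has_mean h2 => w; rewrite e0 mulr1.
have p12 : 1 + 2 * p != 0 by rewrite gt_eqF // addr_gt0 // mulr_gt0.
have [mX lX'] := lX; have [mY lY'] := lY.
have mS := measurable_hermD mX mY.
have pos k : {ae P, forall w, 0 <= hinner (cone_dir k) (X w + Y w)}.
  have [k1 k2] := diag_dominant_opp (cone_dir_dominant (R := R) (b := b) k).
  have : {ae P, forall w, hinner (- cone_dir k) (X w + Y w) <= 0}.
    apply: ae_le0; first exact: mhS.
    move=> n; pose z := n%:R *: (- cone_dir k : herm R b).
    have z1 : htr z <= 0 by rewrite htrZ mulr_ge0_le0.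
    have z2 : 0 <= gamma_form z by rewrite gamma_formZ mulr_ge0 // sqr_ge0.
    have m := gamma_domain_mean hmu (proj1 (gamma_domain_nonpos c1 z1 z2)).
    exists (gamma_laplace p c z * gamma_laplace p c z); split.
      have h0 := gamma_laplace_le1 p0 c1 z1 z2.
      by rewrite mulr_ile1 // powR_ge0.
    apply: eq_has_mean (independent_mean lX lY ind _ _ m m) => [w|y|y]; rewrite ?expR_ge0 //.
    by rewrite -expRD -hinnerDr hinnerZl.
  by apply: filterS => w; rewrite hinnerNl oppr_le0.
split; first by case: h1.
  have [+ _] := has_meanZ (1 + 2 * p) h2.
  rewrite (_ : (fun w => (1 + 2 * p) * _) = (fun w => hcoord ((herm_mx (X w + Y w) ^+ 2) i j) 0 r)) //.
  by apply/funext => w; field.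
apply: laplace_unique => //.
- by case: h1.
- by case: h2.
Qed.

End GammaMoments.

(** * The regression identity for matrices *)

Section MatrixExpectations.
Context {R : realType} {b : dyson} {d : measure_display} {T : measurableType d}.
Variable P : probability T R.
Implicit Types (i j : 'I_2) (r : 'I_b).

Lemma hreal0 : hreal b 0 = 0 :> hring R b.
Proof. by case: b. Qed.

Lemma hcoord_scalar (m : R) i j r :
  hcoord ((hreal b m)%:M i j) 0 r = m * ((i == j) && (val r == 0))%:R.
Proof.
rewrite mxE; case: (i == j); first by rewrite mulr1n hcoord_real mulrC.
by rewrite mulr0n -hreal0 hcoord_real; rewrite !mulr0.
Qed.

Lemma hcoord_mxD (M N : 'M[hring R b]_2) i j r :
  hcoord ((M + N) i j) 0 r = hcoord (M i j) 0 r + hcoord (N i j) 0 r.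
Proof. by rewrite mxE hcoordD mxE. Qed.

Lemma hcoord_mxZ (t : R) (M : 'M[hring R b]_2) i j r :
  hcoord ((hreal b t *: M) i j) 0 r = t * hcoord (M i j) 0 r.
Proof. by rewrite mxE hcoordZ mxE. Qed.

Lemma mx_exp_eq (M : T -> 'M[hring R b]_2) (N : 'M[hring R b]_2) :
  (forall i j r, has_mean P (fun w => hcoord (M w i j) 0 r) (hcoord (N i j) 0 r)) ->
  mx_exp P M = N.
Proof.
move=> h; apply/matrixP => i j; rewrite mxE -[RHS]hcoordK; congr of_hcoord.
by apply/rowP => r; rewrite mxE unlock; have [_ ->] := h i j r.
Qed.

Lemma mulmx_hrealr (t : R) (A B : 'M[hring R b]_2) :
  A *m (hreal b t *: B) = hreal b t *: (A *m B).
Proof.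
apply/matrixP => i j; rewrite !mxE mulr_sumr; apply: eq_bigr => k _.
by rewrite mxE !mulrA hrealC.
Qed.

Lemma herm_affine_sqr (t u : R) (y : herm R b) :
  herm_mx (t *: y + u *: herm1 R b) ^+ 2 =
  hreal b (t ^+ 2) *: herm_mx y ^+ 2 + hreal b (2 * t * u) *: herm_mx y + (hreal b (u ^+ 2))%:M.
Proof.
have -> : 2 * t * u = t * u + u * t by ring.
rewrite !expr2 -!mulmxE /= mulmxDl !mulmxDr -!scalemxAl !mulmx_hrealr !mulmx1 !mul1mx.
by rewrite !scalerA -!hrealM hrealD scalerDl scalemx1 !addrA.
Qed.

Lemma is_cond_exp_comp {d'} {E : measurableType d'} (Z : T -> R) (S : T -> E) (f : E -> R) :
  measurable_fun setT f ->
  P.-integrable setT (EFin \o Z) -> P.-integrable setT (EFin \o (fun w => f (S w))) ->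
  (forall A, measurable A ->
     (\int[P]_(w in S @^-1` A) (f (S w))%:E = \int[P]_(w in S @^-1` A) (Z w)%:E)%E) ->
  is_cond_exp P Z S (fun w => f (S w)).
Proof.
move=> mf hZ hW h; split=> // B mB.
exists (f @^-1` B); last by rewrite setTI.
by rewrite -[X in measurable X]setTI; exact: mf.
Qed.

Lemma measurable_hcoord_sqr i j r :
  measurable_fun setT (fun x : herm R b => hcoord ((herm_mx x ^+ 2) i j) 0 r).
Proof.
have [s [sE _ _]] := @herm_sqr_entry R b i j r.
under eq_fun do rewrite sE.
apply: measurable_sum => k; apply: measurable_funM => //.
by apply: measurable_funX; exact: measurable_hinner.
Qed.

Lemma has_law_id (mu : probability (herm R b) R) : has_law mu (fun x => x) mu.
Proof. by []. Qed.

Lemma measurable_affine (s : R) (y : herm R b) :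
  measurable_fun setT (fun x : herm R b => s *: x + y).
Proof.
by apply: measurable_hermD; [exact: measurable_hermZ|exact: measurable_cst].
Qed.

End MatrixExpectations.

(** * Meixner property, mean and variance, standardization *)

Section GammaEnsembles.
Context {R : realType} {b : dyson}.
Variables (p c : R) (mu : probability (herm R b) R).
Hypotheses (p0 : 0 < p) (c1 : 1 < c) (hmu : gamma_ensemble mu p c).

Lemma gamma_finite_second_moments : finite_second_moments mu.
Proof.
have m v := proj2 (gamma_law_mean c1 hmu (has_law_id mu) v).
have [l [_ hl]] : exists l, has_mean mu (fun x => hinner x x) l.
  eexists; apply: eq_has_mean (has_meanD (has_meanD (m (cone_dir 0)) (m (cone_dir 1)))
    (has_meanZ 2 (has_mean_sum (index_enum 'I_b) (fun r => m (hdir 0 0 1 r))))) => x.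
  rewrite hinner_cone_dir0 hinner_cone_dir1 hinnerE !expr2; congr (_ + 2 * _).
  by apply: eq_bigr => r _; rewrite hinner_hdir; ring.
by rewrite /finite_second_moments hl ltry.
Qed.

Lemma gamma_meixner : meixner_ensemble mu (1 / (1 + 2 * p)) 0 0.
Proof.
split; [exact: (gamma_rotation_invariant p0 c1 hmu)|exact: gamma_finite_second_moments|].
move=> d T P X Y lX lY ind S i j r.
have [hZ hW E] := gamma_regression p0 c1 hmu lX lY ind i j r.
have WE : (fun w => hcoord ((hreal b (1 / (1 + 2 * p)) *: herm_mx (S w) ^+ 2 +
      hreal b 0 *: herm_mx (S w) + (hreal b 0)%:M) i j) 0 r) =
    (fun w => 1 / (1 + 2 * p) * hcoord ((herm_mx (S w) ^+ 2) i j) 0 r).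
  apply/funext => w; rewrite hreal0 scale0r raddf0 !addr0.
  exact: hcoord_mxZ.
rewrite WE; apply: (is_cond_exp_comp (f := fun x =>
  1 / (1 + 2 * p) * hcoord ((herm_mx x ^+ 2) i j) 0 r)).
- by apply: measurable_funM => //; exact: measurable_hcoord_sqr.
- exact: hZ.
- exact: (integrableZl measurableT (1 / (1 + 2 * p)) hW).
- by move=> A mA; rewrite E.
Qed.

Lemma gamma_mean_variance {d : measure_display} {T : measurableType d}
    (P : probability T R) (X : T -> herm R b) : has_law P X mu ->
  mx_exp P (fun w => herm_mx (X w)) =
    (hreal b (2 * p * c * Num.sqrt (1 + b%:R)))%:M /\
  mx_var P (fun w => herm_mx (X w)) = (hreal b (4 * p * c ^+ 2 * (1 + b%:R)))%:M.
Proof.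
move=> lX; have m v := gamma_law_mean c1 hmu lX v.
have E1 : mx_exp P (fun w => herm_mx (X w)) =
    (hreal b (2 * p * c * Num.sqrt (1 + b%:R)))%:M.
  apply: mx_exp_eq => i j r; have [v [vE vt]] := @hcoord_herm_hinner R b i j r.
  rewrite hcoord_scalar -vt; apply: eq_has_mean (proj1 (m v)) => w.
  by rewrite vE.
split=> //; rewrite /mx_var E1.
(* This is E(X^2): only the squared traces of the second moments survive. Subtracting the squared
   mean turns p(p + 1) into p. *)
rewrite (@mx_exp_eq _ _ _ _ P _ (hreal b (4 * p * (p + 1) * c ^+ 2 * (1 + b%:R)))%:M).
  rewrite [_%:M ^+ 2]expr2 -mulmxE -scalar_mxM -hrealM -raddfB; congr (_%:M).
  apply/eqP; rewrite subr_eq -hrealD; apply/eqP; congr hreal.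
  have s2 : Num.sqrt (1 + b%:R) ^+ 2 = 1 + b%:R :> R by rewrite sqr_sqrtr // addr_ge0.
  by set k := Num.sqrt _ in s2 *; rewrite -s2; ring.
move=> i j r; have [s [sE sf st]] := @herm_sqr_entry R b i j r.
rewrite hcoord_scalar -st.
have := has_mean_sum s (fun k => has_meanZ k.1 (proj2 (m k.2))).
rewrite [X in has_mean _ _ X](_ : _ = 4 * p * (p + 1) * c ^+ 2 * (1 + b%:R) *
    (\sum_(k <- s) k.1 * htr k.2 ^+ 2)).
  by apply: eq_has_mean => w; rewrite sE.
transitivity (4 * p * (p + 1) * c ^+ 2 * (1 + b%:R) * (\sum_(k <- s) k.1 * htr k.2 ^+ 2) -
  2 * p * \sum_(k <- s) k.1 * gamma_form k.2); last by rewrite sf mulr0 subr0.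
rewrite !mulr_sumr -sumrB.
by apply: eq_bigr => k _; ring.
Qed.

(** Since m / s = sqrt p, the sum S is s St + 2m I, and S^2 / (s^2 (1+2p)) expands to 4p/(1+2p) (I +
    St/sqrt p + St^2/(4p)). This is where a and b come from; the prefactor is 2/(1+2a). *)
Lemma gamma_standardized {d : measure_display} {T : measurableType d}
    (P : probability T R) (X Xt Yt : T -> herm R b) :
  has_law P X mu -> standardized P X Xt -> same_law P Xt Yt -> independent P Xt Yt ->
  mx_cond_exp P (fun w => herm_mx (Xt w - Yt w) ^+ 2) (fun w => Xt w + Yt w)
    (fun w => hreal b (2 / (1 + 2 * (1 / (4 * p)))) *:
       (1%:M + hreal b (1 / Num.sqrt p) *: herm_mx (Xt w + Yt w)
             + hreal b (1 / (4 * p)) *: herm_mx (Xt w + Yt w) ^+ 2)).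
Proof.
move=> lX [m [s [s0 Em Es XtE]]] [mXt mYt lXY] ind.
have [Em' Es'] := gamma_mean_variance lX.
have scalar_inj (s1 s2 : R) :
    ((hreal b s1)%:M : 'M[hring R b]_2) = (hreal b s2)%:M -> s1 = s2.
  by move=> /matrixP/(_ 0 0); rewrite !mxE !mulr1n => /(congr1 (@hRe R b)); rewrite !hRe_real.
have {Em}mE : m = 2 * p * c * Num.sqrt (1 + b%:R) by apply: scalar_inj; rewrite -Em.
have {Es}sE : s ^+ 2 = 4 * p * c ^+ 2 * (1 + b%:R) by apply: scalar_inj; rewrite -Es.
have msE : m = s * Num.sqrt p.
  have m0 : 0 <= m.
    by rewrite mE !mulr_ge0 ?sqrtr_ge0 // ltW // (lt_trans _ c1).
  have sp0 : 0 <= s * Num.sqrt p by rewrite mulr_ge0 ?sqrtr_ge0 // ltW.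
  apply/eqP; rewrite -(@eqrXn2 _ 2) //.
  rewrite exprMn sE mE exprMn sqr_sqrtr ?addr_ge0 // sqr_sqrtr ?(ltW p0) //.
  by apply/eqP; ring.
have sn0 : s != 0 by rewrite gt_eqF.
pose g (y : herm R b) : herm R b := s *: y + m *: herm1 R b.
have mg : measurable_fun setT g by exact: measurable_affine.
have mgA A : measurable A -> measurable (g @^-1` A).
  by move=> mA; rewrite -[X in measurable X]setTI; exact: mg.
have XE w : X w = g (Xt w).
  by rewrite /g XtE scalerA mulfV // scale1r subrK.
pose Y w := g (Yt w).
(* Undoing the standardization of the copy [Yt] gives a variable with law [mu], to which the
   regression for X and Y applies. *)
have lY : has_law P Y mu.
  split; first exact: measurableT_comp mg mYt.
  move=> A mA; rewrite -(proj2 lX A mA).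
  have -> : Y @^-1` A = Yt @^-1` (g @^-1` A) by [].
  rewrite -lXY; last exact: mgA.
  by congr (P _); apply/seteqP; split => w /=; rewrite XE.
have indXY : independent P X Y.
  move=> A B mA mB; have -> : X @^-1` A = Xt @^-1` (g @^-1` A).
    by apply/seteqP; split => w /=; rewrite XE.
  exact: (ind _ _ (mgA A mA) (mgA B mB)).
move=> i j r; have [hZ hW E] := gamma_regression p0 c1 hmu lX lY indXY i j r.
have ZE w : hcoord ((herm_mx (Xt w - Yt w) ^+ 2) i j) 0 r =
    s ^- 2 * hcoord ((herm_mx (X w - Y w) ^+ 2) i j) 0 r.
  have -> : X w - Y w = s *: (Xt w - Yt w) + 0 *: herm1 R b.
    by rewrite XE /Y /g scale0r addr0 opprD addrACA subrr addr0 scalerBr.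
  rewrite herm_affine_sqr mulr0 expr0n hreal0 scale0r raddf0 !addr0 hcoord_mxZ.
  by rewrite mulrA mulVf ?mul1r // expf_neq0.
have SE w : X w + Y w = s *: (Xt w + Yt w) + (2 * m) *: herm1 R b.
  by rewrite XE /Y /g addrACA -scalerDr -scalerDl; congr (_ + _ *: _); ring.
pose f (x : herm R b) := s ^- 2 * (1 / (1 + 2 * p) *
  hcoord ((herm_mx (s *: x + (2 * m) *: herm1 R b) ^+ 2) i j) 0 r).
have fE x : hcoord ((hreal b (2 / (1 + 2 * (1 / (4 * p)))) *:
       (1%:M + hreal b (1 / Num.sqrt p) *: herm_mx x
             + hreal b (1 / (4 * p)) *: herm_mx x ^+ 2)) i j) 0 r = f x.
  rewrite /f herm_affine_sqr -[(hreal b ((2 * m) ^+ 2))%:M]scalemx1 !(hcoord_mxD, hcoord_mxZ) msE.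
  move: (hcoord _ 0 r) (hcoord _ 0 r) (hcoord _ 0 r) => h1 h2 h3.
  have p12 : 1 + 2 * p != 0 by rewrite gt_eqF // addr_gt0 // mulr_gt0.
  have pn0 : p != 0 by rewrite gt_eqF.
  have sq : Num.sqrt p ^+ 2 = p by rewrite sqr_sqrtr // ltW.
  have sqn0 : Num.sqrt p != 0 by rewrite gt_eqF // sqrtr_gt0.
  move: sq sqn0; set q := Num.sqrt p => sq q0; rewrite -sq in p12 pn0 *.
  by field; rewrite p12 sn0 q0 /= gt_eqF // ltr_wpDl // mulr_ge0 // sqr_ge0.
under [X in is_cond_exp _ _ _ X]eq_fun do rewrite fE.
have fSE w : f (Xt w + Yt w) =
    s ^- 2 * (1 / (1 + 2 * p) * hcoord ((herm_mx (X w + Y w) ^+ 2) i j) 0 r).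
  by rewrite SE.
have intZ : P.-integrable setT (EFin \o (fun w =>
    hcoord ((herm_mx (Xt w - Yt w) ^+ 2) i j) 0 r)).
  under [X in EFin \o X]eq_fun do rewrite ZE.
  exact: (integrableZl measurableT _ hZ).
apply: is_cond_exp_comp.
- apply: measurable_funM => //; apply: measurable_funM => //.
  apply: (measurableT_comp (measurable_hcoord_sqr i j r)).
  exact: measurable_affine.
- exact: intZ.
- rewrite (_ : (fun w => f _) = fun w => s ^- 2 * (1 / (1 + 2 * p) *
    hcoord ((herm_mx (X w + Y w) ^+ 2) i j) 0 r)); last exact/funext.
  exact: (integrableZl measurableT _ (integrableZl measurableT _ hW)).
move=> A mA.
(* The affine inverse that recovers St from S, so conditioning on either is the same. *)
pose k (x : herm R b) : herm R b := s^-1 *: x + (- (s^-1 * (2 * m))) *: herm1 R b.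
have mk : measurable (k @^-1` A).
  by rewrite -[X in measurable X]setTI; exact: measurable_affine.
have kE w : k (X w + Y w) = Xt w + Yt w.
  by rewrite SE /k scalerDr !scalerA mulVf // scale1r -addrA -scalerDl subrr scale0r addr0.
have -> : (fun w => Xt w + Yt w) @^-1` A = (fun w => X w + Y w) @^-1` (k @^-1` A).
  by apply/seteqP; split => w /=; rewrite kE.
have mS : measurable ((fun w => X w + Y w) @^-1` (k @^-1` A)).
  rewrite -[X in measurable X]setTI; apply: measurable_hermD mk => //.
    by case: lX.
  by case: lY.
have iZ := integrableS measurableT mS (@subsetT _ _) hZ.
have iW := integrableS measurableT mS (@subsetT _ _) (integrableZl measurableT (1 / (1 + 2 * p)) hW).
under eq_integral do rewrite fSE EFinM.
under [in RHS]eq_integral do rewrite ZE EFinM.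
by rewrite !integralZl // E.
Qed.

End GammaEnsembles.

Theorem proposition3p10 (R : realType) (beta : dyson) (p c : R)
    (hp : beta%:R / 2 < p) (hc : 1 < c)
    (mu : probability (herm R beta) R) (hmu : gamma_ensemble mu p c) :
  [/\ meixner_ensemble mu (1 / (1 + 2 * p)) 0 0,
      forall (d : measure_display) (T : measurableType d)
             (P : probability T R) (X : T -> herm R beta),
        has_law P X mu ->
        mx_exp P (fun w => herm_mx (X w))
          = (hreal beta (2 * p * c * Num.sqrt (1 + beta%:R)))%:M /\
        mx_var P (fun w => herm_mx (X w))
          = (hreal beta (4 * p * c ^+ 2 * (1 + beta%:R)))%:M &
      forall (d : measure_display) (T : measurableType d)
             (P : probability T R) (X Xt Yt : T -> herm R beta),
        has_law P X mu -> standardized P X Xt ->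
        same_law P Xt Yt -> independent P Xt Yt ->
        let St w := Xt w + Yt w in
        let a := 1 / (4 * p) in
        let b := 1 / Num.sqrt p in
        mx_cond_exp P (fun w => herm_mx (Xt w - Yt w) ^+ 2) St
          (fun w => hreal beta (2 / (1 + 2 * a)) *:
             (1%:M + hreal beta b *: herm_mx (St w)
                   + hreal beta a *: herm_mx (St w) ^+ 2))].
Proof.
have p0 : 0 < p by apply: le_lt_trans hp; rewrite divr_ge0.
split; first exact: (gamma_meixner p0 hc hmu).
  by move=> d T P X lX; exact: (gamma_mean_variance hc hmu lX).
move=> d T P X Xt Yt lX sX sXY ind St a b0.
exact: (gamma_standardized p0 hc hmu lX sX sXY ind).
Qed.
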